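(* Given a positive integer $d$ and $1 > \varepsilon > 0$, there is a constant $n(d,\varepsilon)$ such that the following holds. Let $p \ge q \ge n(d,\varepsilon)$ be positive integers. Then there is a constant $c_{\mathrm{vol}} = c_{\mathrm{vol}}(p,q,d,\varepsilon)$ such that the following is true. For any finite family $\mathcal{F}$ of convex sets in $\mathbb{R}^d$, each of volume at least one, and such that among every $p$ sets in $\mathcal{F}$ there are $q$ whose intersection has volume at least one, we can find $c_{\mathrm{vol}}$ convex sets $C_1, C_2, \ldots, C_{c_{\mathrm{vol}}}$, each of volume $1-\varepsilon$, such that every $F \in \mathcal{F}$ contains at least one $C_i$ (that is, $C_i \subset F$ for some $i$).
   Context: Volume is $d$-dimensional Lebesgue measure. *)

(* Defs.v *)
From HB Require Import structures.
From mathcomp Require Import all_boot all_order all_algebra.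
From mathcomp Require Import all_classical all_reals all_analysis.

Set Implicit Arguments.
Unset Strict Implicit.
Unset Printing Implicit Defensive.

Import Order.TTheory GRing.Theory Num.Theory.
Import numFieldNormedType.Exports.

Local Open Scope classical_set_scope.
Local Open Scope ring_scope.

Section lebesgue_tuple_step.
Context {R : realType} (n : nat).
Let T := measurableTypeR R.

Definition tuple_cons (x : T * n.-tuple T) : n.+1.-tuple T :=
  [the n.+1.-tuple T of x.1 :: x.2].

Lemma measurable_tuple_cons : measurable_fun setT tuple_cons.
Proof. exact: measurable_cons. Qed.

Variable m : {sigma_finite_measure set (n.-tuple T) -> \bar R}.

Definition lebesgue_tuple_step : set (n.+1.-tuple T) -> \bar R :=
  pushforward (@lebesgue_measure R \x m)%E tuple_cons.

Let mpreimage (A : set (n.+1.-tuple T)) :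
  measurable A -> measurable (tuple_cons @^-1` A).
Proof.
by move=> mA; rewrite -[X in measurable X]setTI; exact: measurable_tuple_cons.
Qed.

Let step0 : lebesgue_tuple_step set0 = 0%E.
Proof. by rewrite /lebesgue_tuple_step /pushforward preimage_set0 measure0. Qed.

Let step_ge0 A : (0 <= lebesgue_tuple_step A)%E.
Proof. by rewrite /lebesgue_tuple_step /pushforward measure_ge0. Qed.

Let step_sigma_additive : semi_sigma_additive lebesgue_tuple_step.
Proof.
move=> F mF tF mUF; rewrite /lebesgue_tuple_step /pushforward preimage_bigcup.
apply: measure_semi_sigma_additive.
- by move=> k; exact: mpreimage.
- apply/trivIsetP => /= i j _ _ ij; rewrite -preimage_setI.
  by move/trivIsetP : tF => /(_ _ _ _ _ ij) ->//; rewrite preimage_set0.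
- by rewrite -preimage_bigcup; exact: mpreimage.
Qed.

HB.instance Definition _ := isMeasure.Build _ _ _ lebesgue_tuple_step
  step0 step_ge0 step_sigma_additive.

Let step_sigma_finite : sigma_finite setT lebesgue_tuple_step.
Proof.
have /sigma_finiteP[F [UF ndF mF]] := sigma_finiteT (@lebesgue_measure R).
have /sigma_finiteP[G [UG ndG mG]] := sigma_finiteT m.
pose g (t : n.+1.-tuple T) : T * n.-tuple T := (thead t, [tuple of behead t]).
have mg : measurable_fun setT g.
  by apply/measurable_fun_pair; [exact: measurable_tnth|exact: measurable_behead].
have gK x : g (tuple_cons x) = x.
  by case: x => x t; rewrite /g /tuple_cons theadE; congr pair; exact: val_inj.
exists (fun k => g @^-1` (F k `*` G k)).
  apply/esym; rewrite -subTset => t _.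
  have [i _ Fi] : (\bigcup_k F k) (g t).1 by rewrite -UF.
  have [j _ Gj] : (\bigcup_k G k) (g t).2 by rewrite -UG.
  exists (maxn i j) => //; split.
  - by move: Fi; exact/subsetPset/ndF/leq_maxl.
  - by move: Gj; exact/subsetPset/ndG/leq_maxr.
move=> k; have [mFk Fkoo] := mF k; have [mGk Gkoo] := mG k; split.
  by rewrite -[X in measurable X]setTI; apply: mg => //; exact: measurableX.
rewrite /lebesgue_tuple_step /pushforward -comp_preimage.
rewrite (_ : g \o tuple_cons = id); last by apply/funext => x; exact: gK.
by rewrite preimage_id product_measure1E// lte_mul_pinfty// ge0_fin_numE.
Qed.

HB.instance Definition _ := Measure_isSigmaFinite.Build _ _ _
  lebesgue_tuple_step step_sigma_finite.

End lebesgue_tuple_step.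

Fixpoint lebesgue_tuple {R : realType} (n : nat) :
    {sigma_finite_measure set (n.-tuple (measurableTypeR R)) -> \bar R} :=
  if n is k.+1 then lebesgue_tuple_step (lebesgue_tuple k)
  else \d_ [tuple].

(* A convex set need not be Borel (a disc with an arbitrary part of its boundary
   circle) but it is always Lebesgue measurable, so volume has to be the completed
   measure.  This is a total function: it is the Lebesgue outer measure, whose
   restriction to the Lebesgue measurable sets is the Lebesgue measure. *)
Definition volume {R : realType} {d : nat} (A : set 'rV[R]_d) : \bar R :=
  @completed_measure_extension _ _ _ (@lebesgue_tuple R d)
    [set t : d.-tuple (measurableTypeR R) | A (\row_i tnth t i)].

(* Main.v *)
Require Import Defs.
From HB Require Import structures.
From mathcomp Require Import all_boot all_order all_algebra.
From mathcomp Require Import all_classical all_reals all_analysis.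
From mathcomp Require Import measurable_realfun.
From mathcomp Require Import ring lra.

Set Implicit Arguments.
Unset Strict Implicit.
Unset Printing Implicit Defensive.

Import Order.TTheory GRing.Theory Num.Theory.
Import numFieldNormedType.Exports.

Local Open Scope classical_set_scope.
Local Open Scope ring_scope.

(** The volume condition makes the statement look nonlinear, but it becomes an
    ordinary piercing problem in a higher dimension.

    Fix a grid of small cubes in a large cube. Every convex K of volume at
    least one contains an affine image, under p |-> p *m U + t with U upper
    triangular with positive diagonal, of a union of grid cells whose total
    volume is at least 1 - eps ([grid_approximation]). The union is one of
    finitely many types, namely a set T of cells. For a fixed type T, the pairs
    (U, t) that carry the cells of T into K, and for which the image is large
    enough, form a convex set: the volume of the image is a constant times the
    product of the diagonal of U, and this product is log-concave
    ([grid_fits_conv]). A single pair (U, t) lying in the sets attached to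
    several members of the family is a body of volume at least 1 - eps contained
    in all of them, and it can be cut down to volume exactly 1 - eps
    ([exists_convex_subset_volume]). So it suffices to pierce, by a bounded
    number of points, finitely many types of convex sets in dimension
    D = d^2 + d, when among every p indices some D + 1 have, for one of the
    types, sets with a common point. No volume is lost in this step, and
    n = D + 1.

    Triangular matrices suffice for two reasons. The image of a box under such
    a matrix is a box sheared one coordinate at a time, so its measure follows
    from Fubini by induction on the dimension ([lebesgue_tuple_para]). And a
    convex set is comparable to a triangular parallelepiped: if an inscribed one
    has nearly maximal volume, the convex set lies in a dilate of it by a
    constant that depends on d only, as otherwise the hull with a far point
    would contain a much larger one ([near_maximal_inscribed_covers]). After
    this normalisation a grid of fixed mesh approximates K.

    The piercing theorem ([bounded_piercing]) follows the scheme of Alon and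
    Kleitman. The fractional Helly theorem gives, for each weighting of the
    family, a point of a constant fraction of the weight; multiplicative
    weights turn this into a finite multiset of points such that each set has a
    constant fraction of them; a weak net of bounded size for the multiset
    then meets every set. Both the fractional Helly theorem and the selection
    lemma behind weak nets come from one fact about compact convex sets
    ([minpt_others]), that among more than D sets with a common point one
    contains the point of minimal norm of the intersection of the others. If
    every point were light, a random choice of sets would avoid all such
    coincidences with positive probability ([avoid_events]). *)

(** * Convex hulls, Radon's theorem and points of minimal norm *)

Lemma convex_setP (R : realType) (V : lmodType R) (A : set V) :
  convex_set A <->
  forall x y (t : R), A x -> A y -> 0 <= t -> t <= 1 -> A (t *: x + (1 - t) *: y).
Proof.
split=> [cA x y t Ax Ay t0 t1|H x y t]; last by rewrite !inE => Ax Ay; exact: H.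
by have := cA x y (Itv01 t0 t1); rewrite !inE => /(_ Ax Ay).
Qed.

Lemma convex_bigcap (R : realType) (V : lmodType R) (I : Type) (D : set I)
    (F : I -> set V) :
  (forall i, D i -> convex_set (F i)) -> convex_set (\bigcap_(i in D) F i).
Proof.
move=> cF; apply/convex_setP => x y t Fx Fy t0 t1 i Di.
by apply: ((convex_setP _).1 (cF i Di)) => //; [exact: Fx|exact: Fy].
Qed.

Lemma convex_setI (R : realType) (V : lmodType R) (A B : set V) :
  convex_set A -> convex_set B -> convex_set (A `&` B).
Proof.
move=> /convex_setP cA /convex_setP cB; apply/convex_setP => x y t [? ?] [? ?] ? ?.
by split; [exact: cA|exact: cB].
Qed.

Lemma convex_comb (R : realType) (V : lmodType R) (K : set V) (P : finType)
    (l : P -> R) (u : P -> V) :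
  convex_set K -> (forall s, 0 <= l s) -> \sum_s l s = 1 ->
  (forall s, l s != 0 -> K (u s)) -> K (\sum_s l s *: u s).
Proof.
move=> /convex_setP cK l0 l1 Ku.
have [s0 ls0] : exists s, l s != 0.
  apply/existsP; rewrite -[X in is_true X]negbK negb_exists; apply/negP => /forallP h.
  have := l1; rewrite big1 => [/eqP|s _]; first by rewrite eq_sym oner_eq0.
  by have := h s; rewrite negbK => /eqP.
(* Partial sums are multiples of points of K; the default u s0 serves the
   empty sum. *)
have key (r : seq P) : exists2 z, K z &
    \sum_(s <- r) l s *: u s = (\sum_(s <- r) l s) *: z.
  elim: r => [|s r [z Kz IH]].
    by exists (u s0); [exact: Ku|rewrite !big_nil scale0r].
  rewrite !big_cons IH; set W := \sum_(_ <- _) _.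
  have W0 : 0 <= W by exact: sumr_ge0.
  have [ls|ls] := eqVneq (l s) 0; first by exists z => //; rewrite ls scale0r !add0r.
  have lW : 0 < l s + W by rewrite ltr_wpDr// lt_neqAle eq_sym ls l0.
  exists ((l s / (l s + W)) *: u s + (1 - l s / (l s + W)) *: z).
    apply: cK => //; first exact: Ku.
      by rewrite divr_ge0// ltW.
    by rewrite ler_pdivrMr// mul1r lerDl.
  rewrite scalerDr !scalerA mulrCA mulfV ?gt_eqF// mulr1; congr (_ + _ *: _).
  by rewrite mulrBr mulr1 mulrCA mulfV ?gt_eqF// mulr1 addrAC subrr add0r.
have [z Kz] := key (index_enum P).
by rewrite l1 scale1r => ->.
Qed.

Section hull.
Context {R : realType} {V : lmodType R} {P : finType}.
Implicit Types (u : P -> V) (A B : {set P}).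

(** Explicit coefficients, rather than the intersection of all convex
    supersets, since compactness and Radon's theorem are about the
    coefficients. *)
Definition hull u A : set V := [set x | exists l : P -> R,
  [/\ forall s, 0 <= l s, forall s, s \notin A -> l s = 0,
      \sum_s l s = 1 & x = \sum_s l s *: u s]].

Lemma convex_hull u A : convex_set (hull u A).
Proof.
apply/convex_setP => x y t [l [l0 lA l1 ->]] [m [m0 mA m1 ->]] t0 t1.
exists (fun s => t * l s + (1 - t) * m s); split.
- by move=> s; rewrite addr_ge0// mulr_ge0// subr_ge0.
- by move=> s sA; rewrite lA// mA// !mulr0 addr0.
- by rewrite big_split/= -!mulr_sumr l1 m1; ring.
- rewrite !scaler_sumr -big_split/=; apply: eq_bigr => s _.
  by rewrite [RHS]scalerDl !scalerA.
Qed.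

Lemma hull_sub u A (K : set V) : convex_set K ->
  (forall s, s \in A -> K (u s)) -> hull u A `<=` K.
Proof.
move=> cK Ku x [l [l0 lA l1 ->]]; apply: convex_comb => // s ls; apply: Ku.
by apply: contraNT ls => /lA ->.
Qed.

Lemma hull_in u A s : s \in A -> hull u A (u s).
Proof.
move=> sA; exists (fun i => (i == s)%:R); split.
- by move=> i; rewrite ler0n.
- by move=> i; case: eqP => // -> /negP.
- by rewrite (bigD1 s)//= eqxx big1 ?addr0// => i /negPf ->.
- rewrite (bigD1 s)//= eqxx scale1r big1 ?addr0// => i /negPf ->.
  by rewrite scale0r.
Qed.

Lemma hullS u A B : A \subset B -> hull u A `<=` hull u B.
Proof.
move=> /fintype.subsetP AB; apply: hull_sub; first exact: convex_hull.
by move=> s /AB; exact: hull_in.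
Qed.

Lemma eq_in_hull u v A : {in A, u =1 v} -> hull u A = hull v A.
Proof.
have half u1 u2 : {in A, u1 =1 u2} -> hull u1 A `<=` hull u2 A.
  move=> e; apply: hull_sub; first exact: convex_hull.
  by move=> s sA; rewrite e//; exact: hull_in.
by move=> e; apply/seteqP; split; apply: half => // s sA; rewrite e.
Qed.

End hull.

Lemma hull_comp (R : realType) (V : lmodType R) (P Q : finType) (g : P -> Q)
    (u : Q -> V) (A : {set P}) (B : {set Q}) :
  (forall s, s \in A -> g s \in B) -> hull (u \o g) A `<=` hull u B.
Proof.
move=> gAB; apply: hull_sub; first exact: convex_hull.
by move=> s /gAB; exact: hull_in.
Qed.

Section radon.
Context {R : realType} {D : nat}.
Local Notation V := 'rV[R]_D.

(** The points (u s, 1) are more numerous than the dimension D + 1 of the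
    space they live in. *)
Lemma affine_dependence (P : finType) (u : P -> V) : (D.+1 < #|P|)%N ->
  exists a : P -> R, [/\ \sum_s a s *: u s = 0, \sum_s a s = 0 &
    exists s, 0 < a s].
Proof.
move=> DP.
pose M : 'M[R]_(#|P|, D + 1) := \matrix_i row_mx (u (enum_val i)) (const_mx 1).
have : kermx M != 0.
  rewrite -mxrank_eq0 mxrank_ker subn_eq0 -ltnNge.
  by apply: leq_ltn_trans (rank_leq_col _) _; rewrite addn1.
case/rowV0Pn => v /sub_kermxP vM v0.
pose a s := v 0 (enum_rank s).
have vME : v *m M = row_mx (\sum_s a s *: u s) (const_mx (\sum_s a s)).
  rewrite mulmx_sum_row (reindex (@enum_rank P))/=; last first.
    by exists enum_val => i _; rewrite ?enum_rankK ?enum_valK.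
  under eq_bigr do rewrite rowK enum_rankK scale_row_mx.
  apply/rowP => j; rewrite summxE mxE; case: splitP => k jk.
    rewrite summxE; apply: eq_bigr => s _.
    by rewrite (_ : j = lshift _ k) ?row_mxEl//; exact: val_inj.
  rewrite mxE; apply: eq_bigr => s _.
  by rewrite (_ : j = rshift _ k) ?row_mxEr ?mxE ?mulr1//; exact: val_inj.
move: vME; rewrite vM => /esym/eqP; rewrite -row_mx0 => /eqP/eq_row_mx[a1 a2].
have a0 : \sum_s a s = 0 by have /matrixP/(_ 0 0) := a2; rewrite !mxE.
exists a; split => //.
apply/existsP; rewrite -[X in is_true X]negbK negb_exists; apply/negP => /forallP h.
case/negP: v0; apply/eqP/rowP => i; rewrite mxE -[i]enum_valK -/(a _).
apply/eqP; rewrite -oppr_eq0; apply/eqP.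
apply: (@psumr_eq0P _ _ predT (fun s => - a s)) => //.
  by move=> s _; rewrite oppr_ge0 leNgt.
by rewrite sumrN a0 oppr0.
Qed.

Lemma radon (P : finType) (u : P -> V) : (D.+1 < #|P|)%N ->
  exists A : {set P}, exists x, hull u A x /\ hull u (~: A) x.
Proof.
move=> /(affine_dependence u)[a [au a0 [s0 as0]]].
pose A := [set s | 0 < a s]%SET.
pose W := \sum_(s in A) a s.
have W0 : 0 < W.
  rewrite /W (bigD1 s0)/=; last by rewrite inE.
  by rewrite ltr_wpDr// sumr_ge0// => s; rewrite inE => /andP[/ltW].
have WN : \sum_(s in ~: A) a s = - W.
  apply/eqP; rewrite -addr_eq0 addrC; apply/eqP; rewrite -[RHS]a0.
  by rewrite [RHS](bigID (mem A))/=; congr (_ + _); apply: eq_bigl => s; rewrite inE.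
exists A, (W^-1 *: \sum_(s in A) a s *: u s); split.
- exists (fun s => if s \in A then W^-1 * a s else 0); split.
  + move=> s; case: ifPn => //; rewrite inE => /ltW.
    by apply: mulr_ge0; rewrite invr_ge0 ltW.
  + by move=> s /negPf ->.
  + by rewrite -big_mkcond/= -mulr_sumr mulVf// gt_eqF.
  + rewrite scaler_sumr big_mkcond/=; apply: eq_bigr => s _.
    by case: ifP; rewrite ?scalerA ?scale0r.
- exists (fun s => if s \in ~: A then - W^-1 * a s else 0); split.
  + move=> s; case: ifPn => //; rewrite !inE -leNgt => as_le0.
    by rewrite mulNr -mulrN mulr_ge0// ?oppr_ge0// invr_ge0 ltW.
  + by move=> s /negPf ->.
  + by rewrite -big_mkcond/= -mulr_sumr WN mulrNN mulVf// gt_eqF.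
  + transitivity (- (W^-1 *: \sum_(s in ~: A) a s *: u s)).
      rewrite -scalerN; congr (_ *: _); apply/eqP; rewrite -subr_eq0 opprK.
      apply/eqP; rewrite -[RHS]au [RHS](bigID (mem A))/=; congr (_ + _).
      by apply: eq_bigl => s; rewrite inE.
    rewrite scaler_sumr -sumrN big_mkcond/=; apply: eq_bigr => s _.
    by case: ifP; rewrite ?scalerA ?scale0r// -scaleNr mulNr.
Qed.

(** Helly's theorem is obtained from this by induction on the number of
    sets; a single step, for any number of sets above D + 1, is what the
    point of minimal norm requires. Pick u s in all sets but the s-th one:
    for a Radon point of these choices, each set contains one of the two
    hulls. *)
Lemma helly_step (P : finType) (K : P -> set V) : (D.+1 < #|P|)%N ->
  (forall s, convex_set (K s)) ->
  (forall s, exists x, forall j, j != s -> K j x) ->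
  exists x, forall s, K s x.
Proof.
move=> DP cK /choice[u uK].
have [A [x [xA xC]]] := radon u DP.
exists x => s; have [sA|sA] := boolP (s \in A).
  apply: hull_sub xC => // j; rewrite inE => jA; apply: uK.
  by apply: contraNneq jA => <-.
apply: hull_sub xA => // j jA; apply: uK.
by apply: contraNneq sA => ->.
Qed.

End radon.

Section minimal_point.
Context {R : realType} {D : nat}.
Local Notation V := 'rV[R]_D.

(** The hull is the image of a closed part of the unit cube under a
    continuous map. *)
Lemma compact_hull (P : finType) (u : P -> V) (A : {set P}) :
  compact (hull u A).
Proof.
pose f (l : 'rV[R]_#|P|) : V := \sum_s l 0 (enum_rank s) *: u s.
pose S := [set l : 'rV[R]_#|P| | [/\ forall s, 0 <= l 0 (enum_rank s),
  forall s, s \notin A -> l 0 (enum_rank s) = 0 & \sum_s l 0 (enum_rank s) = 1]].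
have -> : hull u A = f @` S.
  apply/seteqP; split => [x [l [l0 lA l1 ->]]|x [l [l0 lA l1] <-]]; last first.
    by exists (fun s => l 0 (enum_rank s)).
  exists (\row_i l (enum_val i)).
    split => [s|s sA|]; rewrite ?mxE ?enum_rankK//; first exact: lA.
    by under eq_bigr do rewrite mxE enum_rankK.
  by apply: eq_bigr => s _; rewrite mxE enum_rankK.
apply: continuous_compact.
  apply: continuous_subspaceT.
  apply: continuous_big => [|s _]; first exact: add_continuous.
  by move=> l; exact: (cvgZr_tmp (a := u s) (@coord_continuous R 1 #|P| 0 (enum_rank s) l)). 
apply: bounded_closed_compact.
  exists 1; split => // M M1 l [l0 lA l1].
  rewrite /Num.Def.normr/= mx_normrE; apply/bigmax_leP; split.
    by rewrite ltW// (lt_trans _ M1).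
  move=> [i j] _ /=; rewrite ord1 -(enum_valK j) ger0_norm//.
  rewrite (le_trans _ (ltW M1))// -l1 (bigD1 (enum_val j))//= lerDl.
  by rewrite sumr_ge0.
have -> : S = (\bigcap_s [set l | 0 <= l 0 (enum_rank s)]) `&`
   ((\bigcap_(s in [set s | s \notin A]) [set l | l 0 (enum_rank s) = 0]) `&`
   [set l | \sum_s l 0 (enum_rank s) = 1]).
  apply/seteqP; split => l.
  - move=> [a b c]; split; first by move=> s _; exact: a.
    split; last by [].
    by move=> s; exact: b.
  - move=> [a [b c]]; split; last by [].
    + by move=> s; exact: a.
    + by move=> s; exact: b.
have cl (C : set R) (g : 'rV[R]_#|P| -> R) : closed C -> continuous g ->
    closed (g @^-1` C).
  by move=> cC cg; apply: preimage_closed => // *; exact: cg.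
apply: closedI; last apply: closedI.
- apply: closed_bigI => s _.
  apply: (cl [set x | 0 <= x] (fun l => l 0 (enum_rank s))).
    exact: closed_ge.
  exact: coord_continuous.
- apply: closed_bigI => s _.
  apply: (cl [set x | x = 0] (fun l => l 0 (enum_rank s))).
    exact: closed_eq.
  exact: coord_continuous.
- apply: (cl [set x | x = 1] (fun l => \sum_s l 0 (enum_rank s))).
    exact: closed_eq.
  apply: continuous_big => [|s _]; first exact: add_continuous.
  exact: coord_continuous.
Qed.

Definition sqnorm (x : V) : R := \sum_i x 0 i ^+ 2.

(** The square of the Euclidean norm is strictly convex, with an explicit
    defect; hence the open balls are convex and the minimum on a convex set
    is attained at most once. *)
Lemma sqnorm_conv x y t : sqnorm (t *: x + (1 - t) *: y) =
  t * sqnorm x + (1 - t) * sqnorm y - t * (1 - t) * sqnorm (x - y).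
Proof.
rewrite /sqnorm !mulr_sumr -sumrN -!big_split/=; apply: eq_bigr => i _.
rewrite !mxE; ring.
Qed.

Lemma sqnorm_ge0 x : 0 <= sqnorm x.
Proof. by apply: sumr_ge0 => i _; exact: sqr_ge0. Qed.

Lemma sqnorm_eq0 x : sqnorm x = 0 -> x = 0.
Proof.
move=> /eqP; rewrite psumr_eq0 => [/allP h|i _]; last exact: sqr_ge0.
apply/rowP => i; rewrite mxE; apply/eqP.
by have := h i; rewrite mem_index_enum sqrf_eq0; exact.
Qed.

Definition is_minpt (X : set V) (x : V) :=
  X x /\ forall y, X y -> sqnorm x <= sqnorm y.

(** A choice depending on X alone; its uniqueness for convex X is what
    makes it useful. *)
Definition minpt (X : set V) : V := xget 0 (is_minpt X).

Lemma minptP X : X !=set0 -> compact X -> is_minpt X (minpt X).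
Proof.
move=> X0 cX; rewrite /minpt.
have cn : continuous sqnorm.
  apply: continuous_big => [|i _]; first exact: add_continuous.
  move=> x; have := @coord_continuous R 1 D 0 i x => xi.
  rewrite (_ : (fun z : V => z 0 i ^+ 2) = (fun z : V => z 0 i * z 0 i)).
    exact: (cvgM xi xi).
  by apply/funext => z; rewrite expr2.
have [|c cX' cmin] := compact_EVT_min X0 cX (f := sqnorm).
  exact: continuous_subspaceT.
apply: (@xgetI _ 0 (is_minpt X) c); split; first by rewrite inE in cX'.
by move=> y Xy; apply: cmin; rewrite inE.
Qed.

Lemma minpt_unique (X : set V) x : convex_set X -> compact X -> is_minpt X x -> minpt X = x.
Proof.
move=> /convex_setP cvX cX [Xx xmin].
have [Xm mmin] : is_minpt X (minpt X) by apply: minptP => //; exists x.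
set m := minpt X in Xm mmin *.
apply/eqP; rewrite -subr_eq0; apply/eqP/sqnorm_eq0/eqP.
rewrite eq_le sqnorm_ge0 andbT.
have : sqnorm m <= sqnorm (2^-1 *: m + (1 - 2^-1) *: x) by apply/mmin/cvX => //; lra.
have xm := xmin _ Xm; have mx := mmin _ Xx; rewrite sqnorm_conv; lra.
Qed.

(** Let x be the point of minimal norm of the whole intersection. The sets
    K i and the open ball of points of norm smaller than that of x have no
    common point, so by Helly some subfamily obtained by omitting one set
    has none. The omitted set is not the ball, as x lies in all K i; it is
    some K k, and then x minimises the norm on the intersection of the
    other sets. *)
Lemma minpt_others (I : finType) (K : I -> set V) : (0 < D)%N -> (D < #|I|)%N ->
  (forall i, convex_set (K i)) -> (forall i, compact (K i)) ->
  (exists x, forall i, K i x) ->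
  exists k, K k (minpt (\bigcap_(i in [set i | i != k]) K i)).
Proof.
move=> D0 DI cvK cK [x0 x0K].
have clK i : closed (K i) by apply: compact_closed => //; exact: norm_hausdorff.
have cpt (J : set I) : J !=set0 -> compact (\bigcap_(i in J) K i).
  move=> [i Ji]; apply: (subclosed_compact _ (cK i)); first by apply: closed_bigI.
  by move=> x; exact.
have [i0 _] : exists i, i \in I by apply/card_gt0P; exact: leq_ltn_trans DI.
have [xK xmin] : is_minpt (\bigcap_i K i) (minpt (\bigcap_i K i)).
  by apply: minptP; [exists x0 => i _; exact: x0K|apply: cpt; exists i0].
set x := minpt _ in xK xmin.
pose U := [set y : V | sqnorm y < sqnorm x].
have cvU : convex_set U.
  apply/convex_setP => y z t; rewrite /U/= sqnorm_conv => yx zx t0 t1.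
  have h : 0 <= t * (1 - t) * sqnorm (y - z).
    by rewrite !mulr_ge0 ?subr_ge0 ?sqnorm_ge0.
  have [->|tn0] := eqVneq t 0; first by move: zx; rewrite /U/=; lra.
  have tp : 0 < t by rewrite lt_neqAle eq_sym tn0.
  have h1 : t * sqnorm y < t * sqnorm x by rewrite ltr_pM2l.
  have h2 : (1 - t) * sqnorm z <= (1 - t) * sqnorm x.
    by rewrite ler_wpM2l ?subr_ge0// ltW.
  by move: h h1 h2; lra.
(* The extra index None stands for the ball. *)
pose L (o : option I) := if o is Some i then K i else U.
have [k Hk] : exists k, ~ exists y, U y /\ forall j, j != k -> K j y.
  apply: contrapT => /forallNP h.
  have [|||y yL] := @helly_step R D (option I) L.
  - by rewrite card_option.
  - by case.
  - move=> [k|].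
      have [y [Uy yK]] := contrapT (h k).
      by exists y => -[j|//]; move=> jk; apply: yK; apply: contraNneq jk => ->.
    by exists x => -[j|//] _; exact: xK.
  - have := yL None; rewrite /= /U/= ltNge => /negP; apply.
    by apply: xmin => i _; exact: (yL (Some i)).
exists k.
have [j jk] : exists j, j != k.
  apply/existsP; rewrite -[X in is_true X]negbK negb_exists; apply/negP => /forallP h.
  have : (#|I| <= 1)%N.
    apply/card_le1_eqP => a b _ _; have := h a; have := h b.
    by rewrite !negbK => /eqP-> /eqP->.
  by move=> I1; have := leq_trans DI I1; rewrite ltnS leqNgt D0.
rewrite (@minpt_unique _ x).
- exact: xK.
- by apply: convex_bigcap.
- by apply: cpt; exists j.
- split; first by move=> i _; exact: xK.
  move=> y yK; rewrite leNgt; apply/negP => yx; apply: Hk.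
  by exists y.
Qed.

End minimal_point.

(** * Random finite sequences and resampling *)

Section random_choice.
Context {R : realType} {I P : finType} (w : I -> R).
Hypotheses (w_ge0 : forall i, 0 <= w i) (w_sum : \sum_i w i = 1).
Implicit Types (g : {ffun P -> I}) (B : {set P}).

Definition prod_weight g : R := \prod_s w (g s).

Definition resample B g g' : {ffun P -> I} :=
  [ffun s => if s \in B then g' s else g s].

Lemma prod_weight_ge0 g : 0 <= prod_weight g.
Proof. by apply: prodr_ge0. Qed.

Lemma prod_weight_sum : \sum_g prod_weight g = 1.
Proof.
rewrite /prod_weight -(bigA_distr_bigA (fun (_ : P) i => w i)).
by rewrite big1.
Qed.

Lemma prod_weight_coord a (Q : pred I) :
  \sum_(g : {ffun P -> I} | Q (g a)) prod_weight g = \sum_(i | Q i) w i.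
Proof.
pose F s i := if s == a then (if Q i then w i else 0) else w i.
transitivity (\sum_(g : {ffun P -> I}) \prod_s F s (g s)).
  rewrite big_mkcond/=; apply: eq_bigr => g _.
  rewrite [RHS](bigD1 a)//= {1}/F eqxx; case: ifP => _; last by rewrite mul0r.
  rewrite /prod_weight (bigD1 a)//=; congr (_ * _).
  by apply: eq_bigr => s /negPf sa; rewrite /F sa.
rewrite -(bigA_distr_bigA F) (bigD1 a)//= [X in _ * X]big1 ?mulr1; last first.
  by move=> s /negPf sa; rewrite -[RHS]w_sum; apply: eq_bigr => i _; rewrite /F sa.
by rewrite [RHS]big_mkcond; apply: eq_bigr => i _; rewrite /F eqxx.
Qed.

(** Resampling the coordinates in B preserves the product distribution: (g,
    g') |-> (resample B g g', resample B g' g) is an involution that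
    preserves the product weight. *)
Lemma resample_sum B (f : {ffun P -> I} -> R) :
  \sum_g prod_weight g * (\sum_g' prod_weight g' * f (resample B g g')) =
  \sum_g prod_weight g * f g.
Proof.
pose h (x : {ffun P -> I} * {ffun P -> I}) := (resample B x.1 x.2, resample B x.2 x.1).
have hK : involutive h.
  by move=> [g g']; congr pair; apply/ffunP => s; rewrite !ffunE; case: (s \in B).
have mass g g' : prod_weight (resample B g g') * prod_weight (resample B g' g) =
    prod_weight g * prod_weight g'.
  rewrite /prod_weight -!big_split/=; apply: eq_bigr => s _; rewrite !ffunE.
  by case: (s \in B) => //; rewrite mulrC.
transitivity (\sum_g \sum_g' prod_weight g * prod_weight g' * f (resample B g g')).
  by apply: eq_bigr => g _; rewrite mulr_sumr; apply: eq_bigr => g' _; rewrite mulrA.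
rewrite pair_big/= (reindex_inj (inv_inj hK))/=.
under eq_bigr => x _.
  rewrite mass -/(h x).1 (_ : resample _ _ _ = x.1); last by rewrite -[in RHS](hK x).
  over.
rewrite -(pair_big xpredT xpredT (fun g g' => prod_weight g * prod_weight g' * f g))/=.
apply: eq_bigr => g _; rewrite -mulr_suml -mulr_sumr.
by rewrite prod_weight_sum mulr1.
Qed.

(** The union bound, where each event is bounded after conditioning on the
    coordinates outside a block of its own. *)
Lemma avoid_events (E : finType) (phi : E -> pred {ffun P -> I})
    (B : E -> {set P}) (c : R) :
  (forall e g, \sum_(g' | phi e (resample (B e) g g')) prod_weight g' <= c) ->
  #|E|%:R * c < 1 -> exists g, forall e, ~~ phi e g.
Proof.
move=> hc Ec; apply: contrapT => /forallNP h.
have pe e : \sum_(g | phi e g) prod_weight g <= c.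
  pose f g : R := (phi e g)%:R.
  have indE (Q : pred {ffun P -> I}) (g : {ffun P -> I}) :
    prod_weight g * (Q g)%:R = if Q g then prod_weight g else 0.
    by case: ifP; rewrite ?mulr1 ?mulr0.
  have -> : \sum_(g | phi e g) prod_weight g = \sum_g prod_weight g * f g.
    by rewrite big_mkcond; apply: eq_bigr => g _; rewrite indE.
  rewrite -(resample_sum (B e)) -[c]mul1r -prod_weight_sum mulr_suml.
  apply: ler_sum => g _; rewrite ler_wpM2l ?prod_weight_ge0//.
  rewrite (le_trans _ (hc e g))// [leRHS]big_mkcond; apply: ler_sum => g' _.
  by rewrite -(indE (fun g' => phi e (resample (B e) g g'))).
have : 1 <= \sum_e \sum_(g | phi e g) prod_weight g.
  rewrite (exchange_big_dep predT)//= -prod_weight_sum; apply: ler_sum => g _.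
  have [e eg] : exists e, phi e g.
    by apply: contrapT => /forallNP he; apply: (h g) => e; apply/negP.
  rewrite (bigD1 e)//= lerDl sumr_ge0// => *; exact: prod_weight_ge0.
rewrite leNgt => /negP; apply; apply: le_lt_trans Ec.
apply: le_trans (_ : \sum_(e : E) c <= _); first exact: ler_sum.
by rewrite sumr_const mulr_natl.
Qed.

End random_choice.

(** * Tverberg partitions, the selection lemma and weak nets *)

Section weak_nets.
Context {R : realType} {D : nat}.
Local Notation V := 'rV[R]_D.

(** A Tverberg partition into 2^k classes, with (D + 2)^k points instead of
    the optimal number: partition each of D + 2 groups into 2^k classes
    whose hulls share a point, and take a Radon partition of these points.
    Any bound independent of the points is enough. *)
Lemma radon_iterated k : exists P C : finType, #|C| = (2 ^ k)%N /\
  forall u : P -> V, exists part : P -> C, exists x,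
    forall c, hull u [set s | part s == c] x.
Proof.
elim: k => [|k [P [C [cC IH]]]].
  exists unit, unit; split; first by rewrite card_unit.
  by move=> u; exists id, (u tt) => -[]; apply: hull_in; rewrite inE.
exists ('I_D.+2 * P)%type, (bool * C)%type.
split; first by rewrite card_prod card_bool cC expnS.
move=> u.
have /choice[f fP] (j : 'I_D.+2) : exists pz : (P -> C) * V,
    forall c, hull (fun s => u (j, s)) [set s | pz.1 s == c] pz.2.
  by have [part [x h]] := IH (fun s => u (j, s)); exists (part, x).
have [|A [x [xA xC]]] := @radon R D 'I_D.+2 (fun j => (f j).2).
  by rewrite card_ord.
exists (fun js => (js.1 \in A, (f js.1).1 js.2)), x => -[b c].
have sub j : (j \in A) = b ->
    hull (fun s => u (j, s)) [set s | (f j).1 s == c] `<=`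
    hull u [set js | (js.1 \in A, (f js.1).1 js.2) == (b, c)].
  move=> jb; apply: (@hull_comp _ _ _ _ (fun s => (j, s)) u) => s.
  by rewrite !inE jb xpair_eqE eqxx.
case: b sub => sub.
- apply: hull_sub xA; first exact: convex_hull.
  by move=> j jA; apply: (sub j jA); exact: fP.
- apply: hull_sub xC; first exact: convex_hull.
  by move=> j; rewrite inE => /negPf jA; apply: (sub j jA); exact: fP.
Qed.

(** Some point is in the hull of a random tuple with probability bounded
    below. Suppose not. Among the coordinates of a random tuple consider
    all partitions into classes and, for each class, the event that its
    hull contains the point of minimal norm of the intersection of the
    hulls of the other classes. That point does not depend on the
    coordinates of the class, so each event is unlikely, and some tuple
    avoids them all. This contradicts minpt_others for a Tverberg partition
    of that tuple. *)
Lemma selection : (0 < D)%N -> exists P : finType, exists2 c : R, 0 < c &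
  forall (J : finType) (u : J -> V) (w : J -> R),
  (forall j, 0 <= w j) -> \sum_j w j = 1 -> exists x,
  c <= \sum_(g : {ffun P -> J} | `[< hull (u \o g) [set: P]%SET x >]) prod_weight w g.
Proof.
move=> D0; have [P [C [cC tv]]] := radon_iterated D.
exists P; pose E : finType := ({ffun P -> C} * C)%type.
exists (#|E|.+1%:R^-1); first by rewrite invr_gt0 ltr0n.
move=> J u w w0 w1; set gam := _^-1.
apply: contrapT => /forallNP h.
pose block (e : E) c := [set s | e.1 s == c]%SET.
pose Z (e : E) (g : {ffun P -> J}) :=
  minpt (\bigcap_(c in [set c | c != e.2]) hull (u \o g) (block e c)).
pose phi (e : E) (g : {ffun P -> J}) :=
  `[< hull (u \o g) (block e e.2) (Z e g) >].
have [e g||g gP] := avoid_events w0 w1 (phi := phi) (B := fun e => block e e.2) (c := gam).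
- have ZE g' : Z e (resample (block e e.2) g g') = Z e g.
    congr minpt; apply: eq_bigcapr => c /= ce.
    apply: eq_in_hull => s; rewrite !inE /= ffunE inE => /eqP ->.
    by rewrite (negPf ce).
  apply: (@le_trans _ _ (\sum_(g' : {ffun P -> J} |
      `[< hull (u \o g') [set: P]%SET (Z e g) >]) prod_weight w g')).
    rewrite big_mkcond [leRHS]big_mkcond/=; apply: ler_sum => g' _.
    case: ifPn => [/asboolP|_]; last by case: ifP => // _; exact: prod_weight_ge0.
    rewrite ZE => he; rewrite ifT//; apply/asboolP.
    apply: (@hullS _ _ _ _ (block e e.2)); first exact: finset.subsetT.
    rewrite (@eq_in_hull _ _ _ _ (u \o resample (block e e.2) g g'))// => s sB.
    by rewrite /= ffunE sB.
  by rewrite ltW// ltNge; apply/negP; exact: h.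
- by rewrite /gam ltr_pdivrMr ?ltr0n// mul1r ltr_nat.
have [part [x xP]] := tv (u \o g).
have [||||k kP] := @minpt_others R D C (fun c =>
    hull (u \o g) (block ([ffun s => part s], c) c)) D0.
- by rewrite cC ltn_expl.
- by move=> i; exact: convex_hull.
- by move=> i; exact: compact_hull.
- exists x => i; have := xP i; congr (hull _ _ _).
  by apply/setP => s; rewrite !inE ffunE.
have /negP := gP ([ffun s => part s], k); apply; apply/asboolP.
exact: kP.
Qed.

(** Greedy construction: a large S whose hull is not met yet yields by the
    selection lemma a point in the hulls of a constant fraction of all
    tuples of J. These tuples can be taken in S, so none of their hulls was
    met before. The number of steps is therefore bounded. *)
Lemma weak_net (delta : R) : (0 < D)%N -> 0 < delta -> exists c : nat,
  forall (J : finType) (y : J -> V), (0 < #|J|)%N ->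
  exists Z : 'I_c -> V, forall S : {set J},
    delta * #|J|%:R <= #|S|%:R -> exists k, hull y S (Z k).
Proof.
move=> D0 d0; have [P [gam gam0 sel]] := selection D0.
pose kap := gam * delta ^+ #|P|.
have kap0 : 0 < kap by rewrite mulr_gt0 ?exprn_gt0.
(* One step more than the greedy construction can make. *)
pose c := (Num.truncn kap^-1).+1.
have ck : 1 < c%:R * kap by rewrite -ltr_pdivrMr// mul1r truncnS_gt.
exists c => J y J0.
have J0' : 0 < #|J|%:R :> R by rewrite ltr0n.
pose w (_ : J) : R := #|J|%:R^-1.
have w0 j : 0 <= w j by rewrite invr_ge0 ler0n.
have w1 : \sum_j w j = 1 by rewrite sumr_const -[LHS]mulr_natr mulVf ?gt_eqF.
pose pierced (Z : seq V) (g : {ffun P -> J}) :=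
  `[< exists2 z, z \in Z & hull (y \o g) [set: P]%SET z >].
have key n : (exists2 Z : seq V, (size Z <= n)%N & forall S : {set J},
      delta * #|J|%:R <= #|S|%:R -> exists2 z, z \in Z & hull y S z) \/
    exists2 Z, (size Z <= n)%N &
      n%:R * kap <= \sum_(g : {ffun P -> J} | pierced Z g) prod_weight w g.
  elim: n => [|n [[Z Zn ZP]|[Z Zn ZP]]].
  - right; exists [::] => //; rewrite mul0r sumr_ge0// => *; exact: prod_weight_ge0.
  - by left; exists Z => //; rewrite leqW.
  have [works|] := pselect (forall S : {set J}, delta * #|J|%:R <= #|S|%:R ->
      exists2 z, z \in Z & hull y S z).
    by left; exists Z => //; rewrite leqW.
  move=> /existsNP[S /not_implyP[SJ hS']].
  have hS z : z \in Z -> ~ hull y S z by move=> zZ zS; apply: hS'; exists z.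
  have S0 : 0 < #|S|%:R :> R by apply: lt_le_trans SJ; rewrite mulr_gt0.
  pose wS j : R := if j \in S then #|S|%:R^-1 else 0.
  have [||x xP] := sel J y wS.
  - by move=> j; rewrite /wS; case: ifP => // _; rewrite invr_ge0 ltW.
  - by rewrite -big_mkcond/= sumr_const -[LHS]mulr_natr mulVf ?gt_eqF.
  right; exists (x :: Z) => //; rewrite -addn1 natrD mulrDl mul1r.
  pose new (g : {ffun P -> J}) :=
    `[< hull (y \o g) [set: P]%SET x >] && ~~ pierced Z g.
  (* Passing from weights on S to weights on J costs a factor delta per
     coordinate. *)
  have newP : kap <= \sum_(g : {ffun P -> J} | new g) prod_weight w g.
    rewrite /kap mulrC -ler_pdivlMl ?exprn_gt0// mulr_sumr.
    apply: le_trans xP _.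
    rewrite big_mkcond [leRHS]big_mkcond/=; apply: ler_sum => g _.
    case: ifPn => [/asboolP xg|_]; last first.
      by case: ifP => // _; rewrite mulr_ge0 ?invr_ge0 ?exprn_ge0 ?prod_weight_ge0 ?ltW.
    have [gS|gS] := boolP [forall s, g s \in S]; last first.
      have [s sS] : exists s, g s \notin S by apply/existsP; rewrite -negb_forall.
      rewrite /prod_weight (bigD1 s)//= {1}/wS (negPf sS) mul0r.
      by case: ifP => // _; rewrite mulr_ge0 ?invr_ge0 ?exprn_ge0 ?prodr_ge0 ?ltW.
    rewrite ifT; last first.
      apply/andP; split; first exact/asboolP.
      apply/asboolP => -[z zZ zg]; apply: (hS z zZ).
      apply: hull_comp zg => s _; exact: (forallP gS).
    rewrite /prod_weight -prodr_const -prodfV -big_split/=.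
    apply: ler_prod => s _; rewrite /wS (forallP gS s) invr_ge0 ltW//=.
    by rewrite /w -invfM lef_pV2 ?posrE ?mulr_gt0.
  apply: le_trans (lerD ZP newP) _.
  rewrite big_mkcond [X in _ + X]big_mkcond [leRHS]big_mkcond -big_split/=.
  apply: ler_sum => g _; have [pZ|pZ] := boolP (pierced Z g).
    rewrite /new pZ andbF addr0 ifT//; move/asboolP : pZ => [z zZ zg]; apply/asboolP.
    by exists z => //; rewrite inE zZ orbT.
  rewrite add0r; case: ifPn => [/andP[/asboolP xg _]|_].
    by rewrite ifT//; apply/asboolP; exists x => //; rewrite inE eqxx.
  by case: ifP => // _; exact: prod_weight_ge0.
have [[Z Zc ZP]|[Z _ ZP]] := key c; last first.
  have : c%:R * kap <= 1.
    apply: le_trans ZP _; rewrite -(prod_weight_sum w1 (P := P)).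
    by rewrite big_mkcond; apply: ler_sum => g _; case: ifP => // _; exact: prod_weight_ge0.
  by rewrite leNgt ck.
exists (fun k => nth 0 Z k) => S /ZP[z zZ zS].
have iZ : (index z Z < c)%N by apply: leq_trans Zc; rewrite index_mem.
by exists (Ordinal iZ); rewrite /= nth_index.
Qed.

End weak_nets.

(** * Fractional Helly theorem and piercing of convex sets *)

Lemma expr_lt_eps (R : realType) (r e : R) : 0 <= r -> r < 1 -> 0 < e ->
  exists k, r ^+ k < e.
Proof.
move=> r0 r1 e0.
have /cvgrPdist_lt/(_ e e0) : r ^+ n @[n --> \oo] --> (0 : R).
  by apply: cvg_expr; rewrite ger0_norm.
case=> k _ /(_ k); rewrite /= leqnn sub0r normrN ger0_norm ?exprn_ge0// => h.
by exists k; exact: h.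
Qed.

(** This plays the part of linear programming duality in a finite game. The
    weight of i is halved each time i is hit, so each step multiplies the
    total weight by at most r = 1 - c / 2, while an i that has been hit few
    times would keep a large weight. The constant k only has to satisfy r^k
    < 1/2. *)
Lemma multiplicative_weights (R : realType) (c : R) : 0 < c -> c <= 1 ->
  exists k : nat, forall (I : finType) (X : Type) (hit : X -> I -> bool),
  (0 < #|I|)%N ->
  (forall w : I -> R, (forall i, 0 <= w i) -> \sum_i w i = 1 ->
     exists x, c <= \sum_(i | hit x i) w i) ->
  exists N (x : 'I_N -> X), (0 < N)%N /\
    forall i, (N <= k * #|[set s | hit (x s) i]%SET|)%N.
Proof.
move=> c0 c1; pose r := 1 - c / 2.
have r0 : 0 <= r by rewrite /r; lra.
have r1 : r < 1 by rewrite /r; lra.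
have [k kr] := @expr_lt_eps R r 2^-1 r0 r1 ltac:(by rewrite invr_gt0).
exists k => I X hit I0 H.
have II : 0 < #|I|%:R :> R by rewrite ltr0n.
have [m mr] : exists m, (2 * r ^+ k) ^+ m < #|I|%:R^-1.
  apply: expr_lt_eps; last by rewrite invr_gt0.
    by rewrite mulr_ge0 ?exprn_ge0.
  by rewrite mulrC -ltr_pdivlMr// mul1r.
pose h xs i := count (fun x => hit x i) xs.
pose Phi xs : R := \sum_i 2^-1 ^+ h xs i.
have key n : exists2 xs, size xs = n & Phi xs <= #|I|%:R * r ^+ n.
  elim: n => [|n [xs sxs IH]].
    by exists [::] => //; rewrite /Phi expr0 mulr1 /h/= sumr_const expr0.
  have P0 : 0 < Phi xs.
    have /card_gt0P[i _] := I0.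
    rewrite /Phi (bigD1 i)//= ltr_wpDr ?exprn_gt0 ?invr_gt0//.
    by apply: sumr_ge0 => j _; rewrite exprn_ge0 ?invr_ge0.
  have [||x xP] := H (fun i => 2^-1 ^+ h xs i / Phi xs).
  - by move=> i; rewrite divr_ge0 ?exprn_ge0 ?invr_ge0// ltW.
  - by rewrite -mulr_suml mulfV ?gt_eqF.
  exists (x :: xs); first by rewrite /= sxs.
  apply: (@le_trans _ _ (Phi xs * r)); last first.
    by rewrite exprSr mulrA ler_wpM2r.
  have -> : Phi (x :: xs) = Phi xs - 2^-1 * \sum_(i | hit x i) 2^-1 ^+ h xs i.
    rewrite /Phi mulr_sumr [X in _ - X]big_mkcond/= -sumrB; apply: eq_bigr => i _.
    rewrite /h/=; case: (hit x i); last by rewrite add0n subr0.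
    by rewrite add1n exprS; lra.
  move: xP; rewrite -mulr_suml ler_pdivlMr// /r; lra.
have [xs sxs xsP] := key (k * m)%N.
have /card_gt0P[i0 _] := I0.
have km0 : (0 < k * m)%N.
  rewrite muln_gt0; apply/andP; split; rewrite lt0n; apply/eqP => e0.
    by move: kr; rewrite e0 expr0; lra.
  move: mr; rewrite e0 expr0 invf_gt1//.
  by rewrite ltrn1 => /eqP; move: I0; case: #|I|.
have x0 : X by case: xs sxs {xsP} => [|x //] /= e; move: km0; rewrite -e.
exists (k * m)%N, (fun s => nth x0 xs s); split => // i.
have -> : #|[set s : 'I_(k * m) | hit (nth x0 xs s) i]%SET| = h xs i.
  rewrite /h -sum1_count (big_nth x0) sxs big_mkord -sum1_card.
  by apply: eq_bigl => s; rewrite inE.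
rewrite leq_mul2l; apply/orP; right; rewrite leqNgt; apply/negP => hm.
have : 2^-1 ^+ m <= #|I|%:R * r ^+ (k * m).
  apply: le_trans xsP; rewrite /Phi (bigD1 i)//=.
  apply: (@le_trans _ _ (2^-1 ^+ h xs i)); last first.
    by rewrite lerDl sumr_ge0// => j _; rewrite exprn_ge0 ?invr_ge0.
  by apply: ler_wiXn2l; rewrite ?invr_ge0//; [lra|exact: ltnW].
apply/negP; rewrite -ltNge exprM exprVn -[ltRHS]mul1r ltr_pdivlMr ?exprn_gt0//.
move: mr; rewrite -[_^-1]mul1r ltr_pdivlMr// exprMn; nra.
Qed.

Section fractional_helly.
Context {R : realType} {D : nat}.
Local Notation V := 'rV[R]_D.

(** Draw p members of the family independently. If every point carried
    little weight, the draw could be made so that no member is drawn twice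
    and no drawn member contains the point of minimal norm of an
    intersection of other drawn ones. The hypothesis on p members and
    minpt_others exclude this. The Y t i need not be compact, so they are
    replaced by polytopes K t i with the same intersection pattern, spanned
    by one common point of each intersecting subfamily. *)
Lemma fractional_helly (T : finType) (p : nat) : (0 < D)%N ->
  exists c : R, [/\ 0 < c, c <= 1 & forall (I : finType) (Y : T -> I -> set V),
  (forall t i, convex_set (Y t i)) -> (forall i, exists t x, Y t i x) ->
  (forall P : {set I}, #|P| = p -> exists Q : {set I},
     [/\ Q \subset P, (D < #|Q|)%N & exists t x, forall i, i \in Q -> Y t i x]) ->
  forall w : I -> R, (forall i, 0 <= w i) -> \sum_i w i = 1 ->
  exists x : T * V, c <= \sum_(i | `[< Y x.1 i x.2 >]) w i].
Proof.
move=> D0.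
pose E : finType := ('I_p * 'I_p + 'I_p * {set 'I_p} * T)%type.
exists (#|E|.+1%:R^-1); split; first by rewrite invr_gt0 ltr0n.
  by rewrite invf_le1 ?ltr0n// ler1n.
move=> I Y cY Yne Hpq w w0 w1; set c := _^-1.
apply: contrapT => /forallNP heavy.
have light t x (Q : pred I) : (forall i, Q i -> Y t i x) -> \sum_(i | Q i) w i <= c.
  move=> QY; have /negP := heavy (t, x); rewrite -ltNge => /ltW; apply: le_trans.
  rewrite big_mkcond [leRHS]big_mkcond/=; apply: ler_sum => i _.
  case: ifPn => [Qi|_]; last by case: ifP.
  by rewrite ifT//; apply/asboolP; exact: QY.
(* The witness u (t, A) of an intersecting subfamily A is a vertex of K t i
   for each i in A, so K t keeps the intersection pattern of Y t and is
   contained in it. *)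
pose ok t (A : {set I}) := exists x, forall i, i \in A -> Y t i x.
have /choice[u uP] (tA : T * {set I}) :
    exists x, ok tA.1 tA.2 -> forall i, i \in tA.2 -> Y tA.1 i x.
  have [[x h]|h] := pselect (ok tA.1 tA.2); first by exists x.
  by exists 0.
pose K t i := hull (fun A => u (t, A)) [set A : {set I} | (i \in A) && `[< ok t A >]].
have KY t i : K t i `<=` Y t i.
  by apply: hull_sub => // A; rewrite inE => /andP[iA /asboolP okA]; exact: (uP (t, A)).
(* Left events: a repetition. Right events: member a contains the minimal
   point of the members in B. *)
pose phi (e : E) (g : {ffun 'I_p -> I}) := match e with
  | inl (a, b) => (a != b) && (g a == g b)
  | inr (a, B, t) => (a \notin B) &&
      `[< K t (g a) (minpt (\bigcap_(b in [set b | b \in B]) K t (g b))) >]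
  end.
pose block (e : E) : {set 'I_p} := match e with
  | inl (a, b) => [set a] | inr (a, B, t) => [set a] end%SET.
have [e g||g gP] := avoid_events w0 w1 (phi := phi) (B := block) (c := c).
- have pos : 0 <= c by rewrite invr_ge0 ler0n.
  have resa (a b : 'I_p) g' : b != a -> resample [set a] g g' b = g b.
    by rewrite ffunE inE => /negPf ->.
  have resaa (a : 'I_p) g' : resample [set a] g g' a = g' a.
    by rewrite ffunE inE eqxx.
  case: e => [[a b]|[[a B] t]] /=.
  + have [->|ab] := eqVneq a b; first by rewrite big_pred0.
    rewrite (eq_bigl (fun g' : {ffun 'I_p -> I} => g' a == g b)); last first.
      by move=> g'; rewrite /= resaa resa 1?eq_sym.
    rewrite (prod_weight_coord w1 a (fun i => i == g b)).
    have [t [x Yx]] := Yne (g b).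
    by apply: (light t x) => i /eqP ->.
  + have [aB|aB] := boolP (a \in B); first by rewrite big_pred0.
    pose z := minpt (\bigcap_(b in [set b | b \in B]) K t (g b)).
    rewrite (eq_bigl (fun g' : {ffun 'I_p -> I} => `[< K t (g' a) z >])); last first.
      move=> g' /=; rewrite resaa; congr (asbool (K _ _ _)); congr minpt.
      by apply: eq_bigcapr => b /= bB; rewrite resa//; apply: contraNneq aB => <-.
    rewrite (prod_weight_coord w1 a (fun i => `[< K t i z >])).
    by apply: (light t z) => i /asboolP/KY.
- by rewrite /c ltr_pdivrMr ?ltr0n// mul1r ltr_nat.
have g_inj : injective g.
  move=> a b gab; apply/eqP; apply: contraT => ab.
  by have := gP (inl (a, b)); rewrite /= ab gab eqxx.
have [|Q [QP DQ [t [x xQ]]]] := Hpq [set g a | a in 'I_p]%SET.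
  by rewrite card_imset// card_ord.
pose J : finType := {a : 'I_p | g a \in Q}.
have gQ (i : I) : i \in Q -> exists a, g a = i.
  by move=> /(fintype.subsetP QP)/imsetP[a _ ->]; exists a.
have cJ : #|J| = #|Q|.
  rewrite card_sig -(card_imset _ g_inj); apply: eq_card => i; apply/imsetP/idP.
    by move=> [a aQ ->].
  by move=> iQ; have [a ga] := gQ i iQ; exists a; rewrite // unfold_in/= ga.
have [||||k kP] := @minpt_others R D J (fun j => K t (g (val j))) D0.
- by rewrite cJ.
- by move=> j; exact: convex_hull.
- by move=> j; exact: compact_hull.
- exists (u (t, Q)) => -[a aQ]; apply: (@hull_in _ _ _ (fun A => u (t, A))).
  by rewrite inE aQ; apply/asboolP; exists x.
pose B := [set b | (g b \in Q) && (b != val k)]%SET.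
have := gP (inr (val k, B, t)); rewrite /= inE eqxx andbF/= => /negP; apply.
apply/asboolP; move: kP; congr (K _ _ (minpt _)).
apply/seteqP; split => y yK.
  move=> b /=; rewrite inE => /andP[bQ bk].
  by apply: (yK (exist _ b bQ)); rewrite /= -val_eqE.
by move=> [b bQ] /= bk; apply: yK; rewrite /= inE bQ.
Qed.

(** Each set contains a constant fraction of the multiset of pairs given by
    multiplicative_weights, hence, by pigeonhole, for some type t it
    contains a constant fraction of the points, all taken with type t. One
    weak net serves all types. *)
Lemma bounded_piercing (T : finType) (p : nat) : (0 < D)%N ->
  exists c : nat, forall (I : finType) (Y : T -> I -> set V),
  (forall t i, convex_set (Y t i)) -> (forall i, exists t x, Y t i x) ->
  (forall P : {set I}, #|P| = p -> exists Q : {set I},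
     [/\ Q \subset P, (D < #|Q|)%N & exists t x, forall i, i \in Q -> Y t i x]) ->
  exists Z : 'I_c -> T * V, forall i, exists k, Y (Z k).1 i (Z k).2.
Proof.
move=> D0; have [c [c0 c1 FH]] := fractional_helly T p D0.
have [k MW] := multiplicative_weights c0 c1.
pose del : R := (k * #|T|).+1%:R^-1.
have [n net] := @weak_net R D del D0 ltac:(by rewrite invr_gt0 ltr0n).
exists #|{: 'I_n * T}| => I Y cY Yne Hpq.
have [I0|I0] := leqP #|I| 0.
  have noI (i : I) : False by move: I0; rewrite leqn0 => /eqP/card0_eq/(_ i); rewrite inE.
  have [j|] := pselect (exists j : 'I_#|{: 'I_n * T}|, True).
    by exists (fun j => ((enum_val j).2, 0)) => i; case: (noI i).
  move=> h; exists (fun j => ((enum_val j).2, 0)) => i; case: (noI i).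
have [N [x [N0 hit]]] := MW I (T * V)%type (fun x i => `[< Y x.1 i x.2 >]) I0
  (FH I Y cY Yne Hpq).
have [|Z ZP] := net 'I_N (fun s => (x s).2); first by rewrite card_ord.
exists (fun j => ((enum_val j).2, Z (enum_val j).1)) => i.
pose S t := [set s | ((x s).1 == t) && `[< Y (x s).1 i (x s).2 >]]%SET.
have [t tS] : exists t, del * #|'I_N|%:R <= #|S t|%:R.
  apply: contrapT => /forallNP h.
  have := hit i; rewrite leqNgt => /negP; apply.
  have -> : #|[set s | `[< Y (x s).1 i (x s).2 >]]%SET| = (\sum_t #|S t|)%N.
    rewrite -sum1_card (partition_big (fun s => (x s).1) predT)//=.
    by apply: eq_bigr => t _; rewrite -sum1_card; apply: eq_bigl => s; rewrite !inE andbC.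
  rewrite -(ltr_nat R) natrM natr_sum.
  have b (t : T) : true -> #|S t|%:R <= del * N%:R.
    by move=> _; have /negP := h t; rewrite card_ord -ltNge => /ltW.
  apply: (@le_lt_trans _ _ (k%:R * \sum_(t : T) del * N%:R)).
    by rewrite ler_wpM2l// ler_sum.
  have -> : k%:R * \sum_(t : T) del * N%:R = (k * #|T|)%:R / (k * #|T|).+1%:R * N%:R.
    rewrite sumr_const -(mulr_natl (del * _)) natrM !mulrA. rewrite /del; ring.
  by rewrite -[ltRHS]mul1r ltr_pM2r ?ltr0n// ltr_pdivrMr ?ltr0n// mul1r ltr_nat.
have [j jS] := ZP _ tS.
exists (enum_rank (j, t)); rewrite enum_rankK/=.
apply: hull_sub jS => // s; rewrite inE => /andP[/eqP <- /asboolP]; exact.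
Qed.

End fractional_helly.

(** * Measure of triangular parallelepipeds *)

Section parallelepiped_measure.
Context {R : realType}.
Local Notation mR := (measurableTypeR R).

(** Same sets as [para] below, but as sets of tuples, where the measure is
    defined by recursion on the first coordinate. *)
Definition tuple_para n (U : 'I_n -> 'I_n -> R) (t a b : 'I_n -> R) :
    set (n.-tuple mR) :=
  [set x | exists p : 'I_n -> R, forall j,
     a j <= p j < b j /\ tnth x j = \sum_i p i * U i j + t j].

Lemma upper_unit n (U : 'M[R]_n) : (forall i j : 'I_n, (j < i)%N -> U i j = 0) ->
  (forall i, 0 < U i i) -> U \in unitmx.
Proof.
move=> U0 Ud; rewrite unitmxE -det_tr det_trig; last first.
  by apply/is_trig_mxP => i j ij; rewrite mxE U0.
by rewrite unitfE; apply/prodf_neq0 => i _; rewrite mxE gt_eqF.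
Qed.

(** Solving for p presents the set by finitely many inequalities on affine
    functions of x. *)
Lemma measurable_tuple_para n (U : 'I_n -> 'I_n -> R) (t a b : 'I_n -> R) :
  (forall i j : 'I_n, (j < i)%N -> U i j = 0) -> (forall i, 0 < U i i) ->
  measurable (tuple_para U t a b).
Proof.
move=> U0 Ud; pose M := \matrix_(i, j) U i j.
have Mu : M \in unitmx.
  by apply: upper_unit => [i j ij|i]; rewrite mxE//; exact: U0.
pose f j (x : n.-tuple mR) : mR := \sum_i (tnth x i - t i) * invmx M i j.
have mf j : measurable_fun setT (f j).
  apply: measurable_sum => i; apply: measurable_funM => //.
  apply: measurable_funB => //; exact: measurable_tnth.
have -> : tuple_para U t a b = \bigcap_j (f j @^-1` `[a j, b j[%classic).
  apply/seteqP; split => x.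
    move=> [p pP] j _; rewrite /= in_itv/=.
    have -> : f j x = p j; last by have [] := pP j.
    have : (\row_i (tnth x i - t i)) = (\row_i p i) *m M.
      apply/rowP => i; rewrite !mxE (pP i).2 addrK.
      by apply: eq_bigr => k _; rewrite !mxE.
    move=> /(congr1 (fun z => (z *m invmx M) 0 j)); rewrite mulmxK// !mxE => <-.
    by apply: eq_bigr => i _; rewrite mxE.
  move=> h; exists (fun j => f j x) => j; split.
    by have := h j I; rewrite /= in_itv.
  have : (\row_i f i x) *m M = \row_i (tnth x i - t i).
    rewrite (_ : \row_i f i x = (\row_i (tnth x i - t i)) *m invmx M).
      by rewrite mulmxKV.
    by apply/rowP => i; rewrite !mxE; apply: eq_bigr => k _; rewrite mxE.
  move/rowP/(_ j); rewrite !mxE => /esym/(canRL (subrK _)) ->.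
  by congr (_ + _); apply: eq_bigr => i _; rewrite !mxE.
apply: fin_bigcap_measurable => // j _.
by rewrite -[X in measurable X]setTI; exact: mf.
Qed.

(** By induction on the dimension. Fixing the first coordinate x0
    determines p 0, because U is upper triangular; the section is a
    parallelepiped of the same kind with a translation depending on x0,
    hence of constant measure for x0 in an interval and empty for other x0. *)
Lemma lebesgue_tuple_para n (U : 'I_n -> 'I_n -> R) (t a b : 'I_n -> R) :
  (forall i j : 'I_n, (j < i)%N -> U i j = 0) -> (forall i, 0 < U i i) ->
  (forall i, a i <= b i) ->
  lebesgue_tuple n (tuple_para U t a b) = (\prod_i ((b i - a i) * U i i))%:E.
Proof.
elim: n => [|n IH] in U t a b *; move=> U0 Ud ab.
  rewrite big_ord0 /= diracE mem_set//.
  by exists (fun=> 0) => -[].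
have mS := measurable_tuple_para t a b U0 Ud.
set S := tuple_para U t a b in mS *.
rewrite /= /lebesgue_tuple_step /pushforward /= /product_measure1 /=.
pose U' (i j : 'I_n) := U (lift ord0 i) (lift ord0 j).
pose c := \prod_i ((b (lift ord0 i) - a (lift ord0 i)) * U' i i).
pose J := `[a 0 * U 0 0 + t 0, b 0 * U 0 0 + t 0[%classic : set mR.
have IH' t' : lebesgue_tuple n (tuple_para U' t' (fun i => a (lift ord0 i))
    (fun i => b (lift ord0 i))) = c%:E.
  apply: IH => [i j ij|i|i]; [|exact: Ud|exact: ab].
  by apply: U0; rewrite !lift0.
have secE x0 : xsection (@tuple_cons R n @^-1` S) x0 =
    if x0 \in J then tuple_para U' (fun j => t (lift ord0 j) +
       (x0 - t 0) / U 0 0 * U 0 (lift ord0 j))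
      (fun i => a (lift ord0 i)) (fun i => b (lift ord0 i)) else set0.
  have col0 (p : 'I_n.+1 -> R) : \sum_i p i * U i 0 = p 0 * U 0 0.
    rewrite big_ord_recl big1 ?addr0// => i _; rewrite U0 ?mulr0//.
  have JP : (x0 \in J) = (a 0 <= (x0 - t 0) / U 0 0 < b 0).
    rewrite ler_pdivlMr// ltr_pdivrMr// lerBrDr ltrBlDr.
    by apply/idP/idP; rewrite inE /J/= in_itv.
  have U00 : U 0 0 != 0 by rewrite gt_eqF.
  apply/seteqP; split => x.
    rewrite /xsection/= inE /= => -[p pP].
    have p0 : p 0 = (x0 - t 0) / U 0 0.
      by have [_] := pP 0; rewrite col0 (tnth_nth 0)/= => ->; rewrite addrK mulfK.
    rewrite ifT; last by rewrite JP -p0; have [] := pP 0.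
    exists (fun i => p (lift ord0 i)) => j; have [pj xj] := pP (lift ord0 j).
    split => //; move: xj; rewrite tnthS/= => ->.
    by rewrite big_ord_recl -p0 /U'; ring.
  rewrite JP; case: ifPn => // x0J [p pP].
  rewrite /xsection/= inE /=.
  exists (fun i => if unlift ord0 i is Some j then p j else (x0 - t 0) / U 0 0) => j.
  have [k ->|->] := unliftP ord0 j.
    have [pk xk] := pP k; split => //.
    rewrite tnthS/= xk big_ord_recl unlift_none; under [in RHS]eq_bigr do rewrite liftK.
    by rewrite /U'; ring.
  split => //.
  by rewrite col0 unlift_none divfK// subrK (tnth_nth 0).
transitivity (\int[lebesgue_measure]_(x in J) (cst c%:E) x)%E.
  rewrite [RHS]integral_mkcond; apply: eq_integral => x _.
  rewrite /= secE patchE; case: ifP => _; last by rewrite measure0.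
  exact: IH'.
rewrite integral_cst; last exact: measurable_itv.
transitivity (c%:E * lebesgue_measure J)%E; first by [].
rewrite /J lebesgue_measure_itv/= lte_fin ltrD2r ltr_pM2r//.
have -> : \prod_i ((b i - a i) * U i i) = (b 0 - a 0) * U 0 0 * c.
  by rewrite big_ord_recl.
have := ab 0; rewrite le_eqVlt => /predU1P[->|->].
  by rewrite ltxx mule0 subrr !mul0r.
by rewrite -EFinB -EFinM; congr (_%:E); ring.
Qed.

End parallelepiped_measure.

(** * Volume as an outer measure *)

Section volume_theory.
Context {R : realType} {d : nat}.
Local Notation V := 'rV[R]_d.
Local Notation mR := (measurableTypeR R).
Implicit Types (A B : set V) (U : 'M[R]_d) (t a b : V).

Lemma le_volume A B : A `<=` B -> (volume A <= volume B)%E.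
Proof. by move=> AB; apply: le_mu_ext => x; exact: AB. Qed.

Lemma volume_bigcup_le (F : nat -> set V) :
  (volume (\bigcup_k F k) <= \sum_(k <oo) volume (F k))%E.
Proof.
pose T (A : set V) := [set t : d.-tuple mR | A (\row_i tnth t i)].
exact: (mu_ext_sigma_subadditive (measure_ge0 (lebesgue_tuple d)) (fun k => T (F k))).
Qed.

Lemma volume0 : volume (@set0 V) = 0%E.
Proof. exact: (@mu_ext0 _ _ _ _ (measure0 _) (measure_ge0 _)). Qed.

Lemma volume_ge0 A : (0 <= volume A)%E.
Proof. exact: (mu_ext_ge0 (measure_ge0 (@lebesgue_tuple R d))). Qed.

Lemma volumeU_le A B : (volume (A `|` B) <= volume A + volume B)%E.
Proof.
have := volume_bigcup_le (bigcup2 A B).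
rewrite bigcup2E => /le_trans; apply.
rewrite (nneseries_split 0 2)//.
rewrite add0n big_mkord !big_ord_recl big_ord0 /= adde0 eseries0 ?adde0//.
by move=> [|[|k]] //= _ _; rewrite volume0.
Qed.

Lemma volume_bigU_le (I : Type) (s : seq I) (F : I -> set V) :
  (volume (\big[setU/set0]_(i <- s) F i) <= \sum_(i <- s) volume (F i))%E.
Proof.
elim: s => [|i s IH]; first by rewrite !big_nil volume0.
rewrite !big_cons; apply: le_trans (volumeU_le _ _) _.
by rewrite leeD2l.
Qed.

Definition upper_tri U :=
  (forall i j : 'I_d, (j < i)%N -> U i j = 0) /\ (forall i, 0 < U i i).

Definition box a b : set V := [set p | forall j, a 0 j <= p 0 j < b 0 j].

(** A box carried by an upper triangular map, in the row convention:
    coordinate j of the image depends on the coordinates up to j of the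
    box. *)
Definition para U t a b : set V := (fun p => p *m U + t) @` box a b.

Lemma para_tupleE U t a b :
  [set x : d.-tuple mR | para U t a b (\row_i tnth x i)] =
  tuple_para (fun i j => U i j) (t 0) (a 0) (b 0).
Proof.
apply/seteqP; split => x.
  move=> [p pab /rowP xE]; exists (p 0) => j; split; first exact: pab.
  by have := xE j; rewrite !mxE => <-.
move=> [p pP]; exists (\row_i p i); first by move=> j; rewrite mxE; have [] := pP j.
apply/rowP => j; rewrite !mxE (pP j).2; congr (_ + _).
by apply: eq_bigr => i _; rewrite mxE.
Qed.

Lemma volume_para U t a b : upper_tri U -> (forall j, a 0 j <= b 0 j) ->
  volume (para U t a b) = (\prod_i ((b 0 i - a 0 i) * U i i))%:E.
Proof.
move=> [U0 Ud] ab; rewrite /volume para_tupleE.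
rewrite /completed_measure_extension measurable_mu_extE.
  exact: lebesgue_tuple_para.
exact: measurable_tuple_para.
Qed.

(** The map is injective, so disjoint boxes have disjoint images, and
    measurable ones. *)
Lemma volume_paras_ge (K : finType) (Q : {set K}) U t (a b : K -> V) A :
  upper_tri U -> (forall k j, a k 0 j <= b k 0 j) ->
  (forall k l p, box (a k) (b k) p -> box (a l) (b l) p -> k = l) ->
  (forall k, k \in Q -> para U t (a k) (b k) `<=` A) ->
  ((\sum_(k in Q) \prod_i ((b k 0 i - a k 0 i) * U i i))%:E <= volume A)%E.
Proof.
move=> Ut ab disj QA.
have Uu : U \in unitmx by case: Ut; exact: upper_unit.
pose F k := [set x : d.-tuple mR | para U t (a k) (b k) (\row_i tnth x i)].
have mF k : measurable (F k).
  by rewrite /F para_tupleE; case: Ut => ? ?; exact: measurable_tuple_para.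
pose G := \bigcup_(k in [set` Q]) F k.
have mG : measurable G by apply: fin_bigcup_measurable => //; exact: finite_finset.
apply: (@le_trans _ _ (lebesgue_tuple d G)).
  rewrite content_fin_bigcup//; last first.
    move=> k l _ _ [x [[p pk xE] [p' pl]]]; rewrite -xE => /addIr.
    move/(congr1 (mulmx^~ (invmx U))); rewrite !mulmxK// => p'p.
    by apply: (disj k l p) => //; rewrite -p'p.
  rewrite (@fsbigE _ _ _ _ _ (enum Q)) ?enum_uniq//; last 2 first.
  - by move=> k /=; rewrite mem_enum.
  - by move=> k /= kQ; rewrite mem_enum kQ.
  rewrite -sumEFin -big_enum/= [leRHS]big_mkcond/= big_seq [leRHS]big_seq.
  apply: lee_sum => k; rewrite mem_enum => kQ; rewrite ifT; last by rewrite inE.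
  by rewrite -(volume_para t Ut)// /volume /completed_measure_extension measurable_mu_extE//;
    exact: (mF k).
apply: (@le_trans _ _ (volume (\bigcup_(k in [set` Q]) para U t (a k) (b k)))).
  have GE : [set x : d.-tuple mR |
      (\bigcup_(k in [set` Q]) para U t (a k) (b k)) (\row_i tnth x i)] = G.
    by apply/seteqP; split => x [k kQ kx]; exists k.
  by rewrite /volume /completed_measure_extension GE measurable_mu_extE.
by apply: le_volume => x [k kQ kx]; apply: QA kx.
Qed.

End volume_theory.

(** * Volume of convex sets *)

Section convex_volume.
Context {R : realType} {d : nat}.
Local Notation V := 'rV[R]_d.
Implicit Types (A K : set V) (U : 'M[R]_d) (t : V).

Lemma upper_tri1 : upper_tri (1%:M : 'M[R]_d).
Proof.
split=> [i j ij|i]; rewrite !mxE ?eqxx ?ltr01//.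
by rewrite -val_eqE/= gtn_eqF.
Qed.

Lemma volume_box (a b : V) : (forall j, a 0 j <= b 0 j) ->
  volume (box a b) = (\prod_i (b 0 i - a 0 i))%:E.
Proof.
move=> ab; have <- : para 1%:M 0 a b = box a b.
  apply/seteqP; split => x; first by move=> [p pab <-]; rewrite mulmx1 addr0.
  by move=> xab; exists x => //; rewrite mulmx1 addr0.
rewrite volume_para//; last exact: upper_tri1.
by congr _%:E; apply: eq_bigr => i _; rewrite mxE eqxx mulr1.
Qed.

(** Cut A by the half-spaces x 0 i0 < s. The volume of the part cut off is
    a Lipschitz function of s, because slabs of a cube have volume
    proportional to their width, so it takes all intermediate values. *)
Lemma exists_convex_subset_volume (v r : R) A : (0 < d)%N -> convex_set A ->
  (forall x, A x -> forall j, - r <= x 0 j < r) -> 0 <= v ->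
  (v%:E <= volume A)%E ->
  exists C : set V, [/\ convex_set C, C `<=` A & volume C = v%:E].
Proof.
move=> d0 cA Ar v0 vA; pose i0 : 'I_d := Ordinal d0.
have [r0|r0] := leP r 0.
  have A0 : A = set0.
    apply/seteqP; split => // x /Ar/(_ i0); lra.
  exists A; split => //; apply/eqP; rewrite eq_le vA andbT.
  by rewrite A0 volume0 lee_fin.
pose H s := A `&` [set x : V | x 0 i0 < s].
pose M := \prod_(i < d | i != i0) (r + r).
have M0 : 0 <= M by apply: prodr_ge0 => i _; lra.
have Hfin s : volume (H s) \is a fin_num.
  rewrite ge0_fin_numE ?volume_ge0//.
  apply: (@le_lt_trans _ _ (volume (box (const_mx (- r)) (const_mx r) : set V))).
    by apply: le_volume => x [/Ar xr _] j; rewrite !mxE.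
  by rewrite volume_box ?ltry// => j; rewrite !mxE; lra.
pose f s := fine (volume (H s)).
have fE s : volume (H s) = (f s)%:E by rewrite /f fineK.
have fmono s s' : s <= s' -> f s <= f s'.
  move=> ss'; rewrite -lee_fin -!fE; apply: le_volume => x [Ax /= xs].
  by split => //=; exact: lt_le_trans ss'.
have flip s s' : s <= s' -> f s' <= f s + (s' - s) * M.
  move=> ss'; rewrite -lee_fin EFinD -!fE.
  pose a : V := \row_i (if i == i0 then s else - r).
  pose b : V := \row_i (if i == i0 then s' else r).
  apply: (@le_trans _ _ (volume (H s `|` box a b))).
    apply: le_volume => x [Ax /= xs'].
    have [xs|xs] := ltP (x 0 i0) s; [by left; split|right].
    by move=> j; rewrite !mxE; case: eqP => [->|_]; [rewrite xs|exact: Ar].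
  apply: le_trans (volumeU_le _ _) _; rewrite leeD2l// volume_box.
    rewrite lee_fin (bigD1 i0)//= !mxE eqxx /M.
    by under eq_bigr => i /negPf ii do rewrite !mxE ii opprK.
  by move=> j; rewrite !mxE; case: eqP => // _; lra.
have fc : continuous f.
  move=> s; apply/cvgrPdist_lt => e e0.
  have M1 : 0 < M + 1 by lra.
  near=> x.
  have xs : `|s - x| * (M + 1) < e.
    rewrite -ltr_pdivlMr//; near: x.
    by have /cvgrPdist_lt := @cvg_id _ (nbhs s); apply; rewrite divr_gt0.
  apply: le_lt_trans xs.
  have [sx|xs] := leP s x.
    have := fmono _ _ sx; have := flip _ _ sx.
    rewrite !ler0_norm ?subr_le0//; first nra.
    exact: fmono.
  have := fmono _ _ (ltW xs); have := flip _ _ (ltW xs).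
  rewrite !ger0_norm ?subr_ge0//; [nra|exact: ltW|].
  exact: fmono (ltW xs).
have Hr : H r = A.
  by apply/seteqP; split => x; [case|move=> Ax; split => //=; have /andP[] := Ar x Ax i0].
have H0 : f (- r) = 0.
  rewrite /f (_ : H _ = set0) ?volume0//; apply/seteqP; split => // x [/Ar/(_ i0)/=].
  by move=> /andP[h _]; rewrite ltNge h.
have [|||s _ fs] := @IVT R f (- r) r v.
- lra.
- exact: continuous_subspaceT.
- have fr : v <= f r by rewrite -lee_fin -fE Hr.
  by rewrite ge_min H0 v0 le_max fr orbT.
exists (H s); split; last by rewrite fE fs.
- apply: convex_setI => //; apply/convex_setP => x y t /=; rewrite !mxE => xs ys t0 t1.
  have [->|tn0] := eqVneq t 0; first lra.
  have tp : 0 < t by rewrite lt_neqAle eq_sym tn0.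
  nra.
- by move=> x [].
Unshelve. all: by end_near. Qed.

(** Inside a cube, the hyperplane lies in a triangular parallelepiped of
    arbitrarily small width in the direction i, where i is the last
    coordinate with nonzero coefficient: the equation then expresses x i by
    earlier coordinates, which an upper triangular shear can do. *)
Lemma volume_hyperplane (a : 'cV[R]_d) (c : R) : a != 0 ->
  volume [set x : V | (x *m a) 0 0 = c] = 0%E.
Proof.
move=> a0; set H := [set x | _].
have [j0 aj0] : exists j, a j 0 != 0.
  apply/existsP; rewrite -[X in is_true X]negbK negb_exists; apply: contra a0.
  move=> /forallP h; apply/eqP/colP => j; rewrite mxE; apply/eqP.
  by have := h j; rewrite negbK.
case: (@arg_maxnP _ j0 (fun j => a j 0 != 0) (fun j => val j) aj0) => i ai imax.
pose S (n : nat) := H `&` [set x : V | forall j, - n%:R <= x 0 j < n%:R].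
have S0 n : volume (S n) = 0%E.
  apply/eqP; rewrite eq_le volume_ge0 andbT.
  pose M : R := \prod_(j < d | j != i) (n%:R + n%:R).
  have M0 : 0 <= M by apply: prodr_ge0 => j _; rewrite addr_ge0.
  apply/lee_addgt0Pr => e e0; rewrite add0e.
  (* The image of p with p i in [0, w) is a one-sided neighbourhood of
     width w of the graph of x i as a function of the earlier coordinates. *)
  pose U : 'M[R]_d := \matrix_(k, j) (if (j == i) && (k < i)%N
     then - (a k 0 / a i 0) else (k == j)%:R).
  pose t : V := \row_j (if j == i then c / a i 0 else 0).
  pose lo : V := \row_j (if j == i then 0 else - n%:R).
  pose hi : V := \row_j (if j == i then e / (M + 1) else n%:R).
  have M1 : 0 < M + 1 by lra.
  have Ut : upper_tri U.
    split => [k j jk|k]; rewrite mxE.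
      rewrite ifF; last first.
        by apply/negP => /andP[/eqP ji ki]; move: jk; rewrite ji ltnNge (ltnW ki).
      by rewrite -val_eqE/= gtn_eqF.
    rewrite ifF ?eqxx ?ltr01//.
    by apply/negP => /andP[/eqP ki]; rewrite ki ltnn.
  apply: (@le_trans _ _ (volume (para U t lo hi))).
    apply: le_volume => x [xa xn].
    exists (\row_j (if j == i then 0 else x 0 j)).
      move=> j; rewrite !mxE; case: eqP => _; last exact: xn.
      by rewrite lexx divr_gt0.
    apply/rowP => j; rewrite !mxE.
    under eq_bigr do rewrite !mxE.
    have [->|ji] := eqVneq j i; last first.
      rewrite addr0 (bigD1 j)//= (negPf ji) eqxx mulr1 big1 ?addr0// => k kj.
      by rewrite (negPf kj) mulr0.
    apply: (mulIf ai); rewrite mulrDl divfK// mulr_suml -xa mxE.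
    rewrite (bigD1 i)//= [X in _ + X](bigD1 i)//= !eqxx !mul0r add0r addrCA -big_split/=.
    rewrite big1 ?addr0// => k ki; rewrite (negPf ki).
    have [lt_ki|] := ltnP k i; first by rewrite mulrN mulNr -mulrA divfK// addrC subrr.
    rewrite leq_eqVlt => /predU1P[/val_inj ik|ik]; first by rewrite ik eqxx in ki.
    rewrite mulr0 mul0r add0r; apply/eqP; rewrite mulf_eq0; apply/orP; right.
    by apply: contraT => ak; have := imax k ak; rewrite /= leqNgt ik.
  rewrite volume_para//; last first.
    move=> j; rewrite !mxE; case: eqP => _; first by rewrite divr_ge0// ltW.
    by rewrite -subr_ge0 opprK addr_ge0.
  rewrite lee_fin (bigD1 i)//= !mxE eqxx ltnn/= mulr1 subr0.
  rewrite (_ : \prod_(j < d | j != i) _ = M).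
    rewrite mulrAC ler_pdivrMr// ler_pM2l//; lra.
  apply: eq_bigr => j ji; rewrite !mxE (negPf ji) /= eqxx mulr1 opprK//.
apply/eqP; rewrite eq_le volume_ge0 andbT.
apply: (@le_trans _ _ (volume (\bigcup_n S n))).
  apply: le_volume => x xH.
  exists (Num.truncn (\sum_j `|x 0 j|)).+1 => //; split => // j.
  have : `|x 0 j| < (Num.truncn (\sum_j `|x 0 j|)).+1%:R.
    apply: le_lt_trans (truncnS_gt _).
    by rewrite (bigD1 j)//= lerDl sumr_ge0.
  by rewrite ltr_norml => /andP[/ltW -> ->].
apply: le_trans (volume_bigcup_le _) _.
by rewrite eseries0// => k _ _; rewrite S0.
Qed.

End convex_volume.

(** * Triangular parallelepipeds inscribed in convex sets *)

Section inscribed_boxes.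
Context {R : realType} {d : nat}.
Local Notation V := 'rV[R]_d.
Implicit Types (K : set V) (U : 'M[R]_d) (t : V).

Definition inscribed K U t :=
  upper_tri U /\ forall p : V, (forall j, `|p 0 j| <= 1) -> K (p *m U + t).

(** Extend a free family of differences x - x0 as long as they are not all
    killed by a linear form vanishing on the family. *)
Lemma hyperplane_or_frame K (x0 : V) :
  (exists2 a : 'cV[R]_d, a != 0 & forall x, K x -> (x - x0) *m a = 0) \/
  (exists2 B : 'M[R]_d, B \in unitmx & forall i, K (x0 + row i B)).
Proof.
have key r : (r <= d)%N ->
  (exists2 a : 'cV[R]_d, a != 0 & forall x, K x -> (x - x0) *m a = 0) \/
  (exists2 B : 'M[R]_(r, d), row_free B & forall i, K (x0 + row i B)).
  elim: r => [|r IH] rd.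
    by right; exists 0 => [|[]//]; rewrite /row_free mxrank0.
  have [|[B Bfree KB]] := IH (ltnW rd); first by left.
  have : cokermx B != 0.
    by rewrite -mxrank_eq0 mxrank_coker (eqP Bfree) subn_eq0 -ltnNge.
  rewrite -trmx_eq0 => /rowV0Pn[v /submxP[w0 vE] v0].
  pose a := v^T.
  have Ba : B *m a = 0.
    by rewrite /a vE trmx_mul trmxK mulmxA mulmx_coker mul0mx.
  have a0 : a != 0 by rewrite /a trmx_eq0.
  have [ka|] := pselect (forall x, K x -> (x - x0) *m a = 0); first by left; exists a.
  move=> /existsNP[x /not_implyP[Kx xa]].
  have free : row_free (col_mx (x - x0) B).
    rewrite -kermx_eq0; apply/rowV0P => w /sub_kermxP.
    rewrite -[w]hsubmxK mul_row_col => e.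
    have w1 : lsubmx w = 0.
      move/(congr1 (mulmx^~ a)): e; rewrite mulmxDl -!mulmxA Ba mulmx0 addr0 mul0mx.
      rewrite [lsubmx w]mx11_scalar mul_scalar_mx => /eqP; rewrite scaler_eq0.
      by case/orP => /eqP // ->; rewrite raddf0.
    move: e; rewrite w1 mul0mx add0r => e.
    suff -> : rsubmx w = 0 by rewrite row_mx0.
    by apply: (row_free_inj Bfree); rewrite mul0mx.
  have rows (i : 'I_(1 + r)) : K (x0 + row i (col_mx (x - x0) B)).
    case: (split_ordP i) => j ->; last by rewrite rowKd.
    by rewrite rowKu row_id addrC subrK.
  by right; exists (col_mx (x - x0) B).
have [|[B Bf KB]] := key d (leqnn d); first by left.
by right; exists B => //; rewrite -row_free_unit.
Qed.

(** A convex set of positive volume is in no hyperplane, so it contains a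
    nondegenerate simplex, and a small cube around a point inside the
    simplex. *)
Lemma exists_inscribed K : (0 < d)%N -> convex_set K -> volume K != 0%E ->
  exists U t, inscribed K U t.
Proof.
move=> d0 cK vK.
have [x0 Kx0] : K !=set0.
  by apply/set0P; apply: contra vK => /eqP ->; rewrite volume0.
have [[a a0 aK]|[B Bu KB]] := hyperplane_or_frame K x0.
  case/negP: vK; rewrite eq_le volume_ge0 andbT -(volume_hyperplane ((x0 *m a) 0 0) a0).
  apply: le_volume => x /aK /=; rewrite mulmxBl => /eqP; rewrite subr_eq0.
  by move=> /eqP ->.
pose S := \sum_i \sum_j `|invmx B i j|.
have S0 : 0 <= S by apply: sumr_ge0 => i _; exact: sumr_ge0.
have dR : 0 < d%:R :> R by rewrite ltr0n.
(* The center of the cube is x0 + g (v_1 + ... + v_d), with v_i the rows of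
   B; coefficients within g of the center keep nonnegative and of sum at
   most 1. *)
pose g := (2 * d%:R)^-1 : R.
have g0 : 0 < g by rewrite invr_gt0 mulr_gt0.
pose eta := g / (S + 1).
have eta0 : 0 < eta by rewrite divr_gt0//; lra.
exists (eta%:M), (x0 + const_mx g *m B); split.
  split=> [i j ij|i]; rewrite mxE ?eqxx//.
  by rewrite -val_eqE /= gtn_eqF// mulr0n.
move=> p p1; pose q := const_mx g + eta *: (p *m invmx B).
have qb i : 0 <= q 0 i <= d%:R^-1.
  have h : `|eta * (p *m invmx B) 0 i| <= g.
    rewrite normrM (gtr0_norm eta0) /eta -mulrA ler_piMr ?(ltW g0)//.
    rewrite mulrC ler_pdivrMr; last lra.
    rewrite mul1r mxE; apply: (@le_trans _ _ S); last lra.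
    apply: le_trans (ler_norm_sum _ _ _) _; apply: ler_sum => j _.
    rewrite normrM (bigD1 i)//=; apply: (@le_trans _ _ (`|invmx B j i|)).
      by rewrite ler_piMl.
    by rewrite lerDl sumr_ge0.
  rewrite !mxE; move: h; rewrite mxE ler_norml.
  have -> : d%:R^-1 = g + g.
    by rewrite /g; field; rewrite gt_eqF.
  by move=> /andP[? ?]; apply/andP; split; lra.
have -> : p *m eta%:M + (x0 + const_mx g *m B) = x0 + q *m B.
  rewrite addrCA; congr (_ + _); rewrite mulmxDl addrC; congr (_ + _).
  by rewrite -scalemxAl -mulmxA mulVmx// mulmx1 mul_mx_scalar.
pose l (o : option 'I_d) := if o is Some i then q 0 i else 1 - \sum_i q 0 i.
pose u (o : option 'I_d) := if o is Some i then x0 + row i B else x0.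
have sum_opt (W : nmodType) (f : option 'I_d -> W) :
    \sum_o f o = f None + \sum_i f (Some i).
  rewrite (bigD1 None)//=; congr (_ + _).
  rewrite (reindex_omap Some id)/=; last by case.
  by apply: eq_bigl => i; rewrite eqxx.
have -> : x0 + q *m B = \sum_o l o *: u o.
  rewrite sum_opt /= mulmx_sum_row scalerBl scale1r scaler_suml.
  under [X in _ = _ + X]eq_bigr do rewrite scalerDr.
  by rewrite big_split/= addrA subrK.
apply: convex_comb => //.
- move=> [i|]; rewrite /l; first by have /andP[] := qb i.
  rewrite subr_ge0; apply: (@le_trans _ _ (\sum_(i < d) d%:R^-1)).
    by apply: ler_sum => i _; have /andP[] := qb i.
  by rewrite sumr_const card_ord -[leLHS]mulr_natr mulVf ?gt_eqF.
- by rewrite sum_opt /= subrK.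
- by move=> [i|] _ //=; exact: KB.
Qed.

Lemma upper_triM U U' : upper_tri U -> upper_tri U' ->
  upper_tri (U *m U') /\ forall i, (U *m U') i i = U i i * U' i i.
Proof.
move=> [U0 Ud] [U0' Ud'].
have dE i : (U *m U') i i = U i i * U' i i.
  rewrite mxE (bigD1 i)//= big1 ?addr0// => k ki.
  have [ik|] := ltnP k i; first by rewrite U0// mul0r.
  rewrite leq_eqVlt => /predU1P[/val_inj ik|ik]; first by rewrite ik eqxx in ki.
  by rewrite U0' ?mulr0.
split => //; split=> [i j ji|i]; last by rewrite dE mulr_gt0.
rewrite mxE big1// => k _; have [ki|ik] := ltnP k i; first by rewrite U0 ?mul0r.
by rewrite U0' ?mulr0// (leq_trans ji).
Qed.

(** The radii grow with the coordinate: in near_maximal_inscribed_covers, a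
    coordinate exceeding its radius must do so by a large factor compared
    with all earlier coordinates. *)
Fixpoint outer_radius (n : nat) : R :=
  if n is m.+1 then 2 ^+ d.+2 * (1 + outer_radius m) else 0.

Lemma outer_radius_ge0 n : 0 <= outer_radius n.
Proof. by elim: n => //= n IH; rewrite mulr_ge0 ?exprn_ge0// addr_ge0. Qed.

Lemma outer_radius_le m n : (m <= n)%N -> outer_radius m <= outer_radius n.
Proof.
move=> /subnKC <-; elim: (n - m)%N => [|k IH]; first by rewrite addn0.
apply: le_trans IH _; rewrite addnS /=.
have := outer_radius_ge0 (m + k).
have : (1 : R) <= 2 ^+ d.+2 by apply: exprn_ege1; rewrite ler1n.
nra.
Qed.

(** Let i be the first coordinate of y exceeding its radius, so that the
    earlier ones are at most mu = outer_radius i. The hull of the cube and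
    y contains the points s y + (1 - s) e for s at most s0 and e in the
    cube. In it, halve the cube and stretch the direction i along y: the
    earlier coordinates move by at most s0 mu, which the halving absorbs,
    and the later ones are moved by a shear from coordinate i, which is
    upper triangular. The product of the diagonal is multiplied by 2^-d s0
    |y i|, at least 2 by the choice of the radii. *)
Lemma near_maximal_inscribed_covers K U t : convex_set K -> inscribed K U t ->
  (forall U' t', inscribed K U' t' -> \prod_i U' i i < 2 * \prod_i U i i) ->
  forall y, K (y *m U + t) -> forall j : 'I_d, `|y 0 j| <= outer_radius j.+1.
Proof.
move=> /convex_setP cK [Ut KU] max y Ky j0; rewrite leNgt; apply/negP => yj0.
case: (@arg_minnP _ j0 (fun j : 'I_d => outer_radius j.+1 < `|y 0 j|) val yj0) => i yi imin.
pose mu := outer_radius i; pose s0 := (2 * (1 + mu))^-1 : R.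
have mu0 : 0 <= mu by exact: outer_radius_ge0.
have s00 : 0 < s0 by rewrite invr_gt0; lra.
have s0mu : s0 * (1 + mu) = 2^-1 by rewrite /s0 invfM mulrVK// unitfE; lra.
have ylow (j : 'I_d) : (j < i)%N -> `|y 0 j| <= mu.
  move=> ji; rewrite leNgt; apply/negP => /= h.
  have : outer_radius j.+1 < `|y 0 j|.
    by apply: le_lt_trans h; exact: outer_radius_le.
  by move=> /imin; rewrite leqNgt ji.
have yi0 : 0 < `|y 0 i| by apply: le_lt_trans yi; exact: outer_radius_ge0.
pose sg := Num.sg (y 0 i).
have sgy : sg * y 0 i = `|y 0 i| by rewrite normrEsg.
have sg1 : sg * sg = 1.
  by rewrite /sg; case: sgrP yi0; rewrite ?normr0 ?ltxx//; lra.
(* New parallelepiped in the coordinates of the old one. Only row i is not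
   diagonal; sg is the sign of y i, which keeps the diagonal positive. *)
pose U0 : 'M[R]_d := \matrix_(k, j)
  if k == j then 2^-1 * (if j == i then s0 * `|y 0 i| else 1)
  else if (k == i) && (i < j)%N then s0 * sg * y 0 j / 2 else 0.
pose t0 : V := \row_j if (i <= j)%N then s0 * y 0 j / 2 else 0.
have U0t : upper_tri U0.
  split=> [k j jk|k]; rewrite mxE; last first.
    by rewrite eqxx mulr_gt0 ?invr_gt0//; case: ifP => // _; rewrite mulr_gt0.
  rewrite -val_eqE/= gtn_eqF// ifF//; apply/negP => /andP[/eqP ki ij].
  by move: jk; rewrite ki ltnNge ltnW.
have [UUt UUd] := upper_triM U0t Ut.
have : inscribed K (U0 *m U) (t0 *m U + t).
  split => // p p1; rewrite mulmxA addrA -mulmxDl.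
  pose s := s0 * (1 + sg * p 0 i) / 2.
  have sgp : `|sg * p 0 i| <= 1.
    rewrite normrM; suff -> : `|sg| = 1 by rewrite mul1r.
    by rewrite /sg normr_sg; move: yi0; rewrite normr_gt0 => ->.
  have /andP[s_ge0 s_le] : 0 <= s <= s0.
    by move: sgp; rewrite ler_norml /s => /andP[? ?]; apply/andP; split; nra.
  have s0_half : s0 <= 2^-1 by rewrite -s0mu; nra.
  have zE (j : 'I_d) : (p *m U0 + t0) 0 j = (if (i <= j)%N then s * y 0 j else 0) +
      (if j == i then 0 else p 0 j / 2).
    rewrite !mxE (bigD1 j)//= mxE eqxx.
    have [->|ji] := eqVneq j i.
      rewrite leqnn big1 => [|k ki]; last by rewrite mxE (negPf ki) ltnn andbF mulr0.
      by rewrite -sgy /s !addr0; field.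
    have [ij|] := ltnP i j.
      rewrite (ltnW ij) (bigD1 i) 1?eq_sym//= mxE eq_sym (negPf ji) eqxx ij /=.
      rewrite big1 => [|k /andP[kj ki]]; last by rewrite mxE (negPf kj) (negPf ki) mulr0.
      by rewrite /s; field.
    rewrite leq_eqVlt => /predU1P[/val_inj e|lt_ji]; first by rewrite e eqxx in ji.
    rewrite leqNgt lt_ji /= big1 => [|k kj]; last first.
      by rewrite mxE (negPf kj) ltnNge (ltnW lt_ji) andbF mulr0.
    by rewrite mulr1 !addr0 add0r.
  (* The point z of the new parallelepiped is s y + (1 - s) e with e in the
     cube, where s = z i / y i. *)
  pose e := (1 - s)^-1 *: (p *m U0 + t0 - s *: y).
  have s1 : 0 < 1 - s by lra.
  have -> : p *m U0 + t0 = s *: y + (1 - s) *: e.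
    by rewrite /e scalerA mulfV ?gt_eqF// scale1r [RHS]addrC subrK.
  rewrite (_ : _ *m U + t = s *: (y *m U + t) + (1 - s) *: (e *m U + t)); last first.
    rewrite mulmxDl -!scalemxAl [in RHS]scalerDr [X in _ = _ + X]scalerDr.
    rewrite addrACA -(scalerDl t).
    by rewrite (addrC s (1 - s)) subrK scale1r.
  apply: cK => //; last lra.
  apply: KU => j; rewrite /e mxE normrM gtr0_norm ?invr_gt0// mulrC ler_pdivrMr// mul1r.
  rewrite mxE zE !mxE; have pj := p1 j.
  have pj2 : `|p 0 j / 2| <= 2^-1 by rewrite normrM [`|2^-1|]gtr0_norm ?invr_gt0//; lra.
  have [ij|ji] := leqP i j.
    rewrite addrAC subrr add0r; case: ifP => _; first by rewrite normr0 ltW.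
    lra.
  rewrite ifF; last by apply/negP => /eqP e'; rewrite e' ltnn in ji.
  rewrite add0r; apply: le_trans (ler_normB _ _) _.
  rewrite (normrM s) (ger0_norm s_ge0); have := ylow j ji; have := normr_ge0 (y 0 j); nra.
move=> /max; apply/negP; rewrite -leNgt.
rewrite [leRHS](eq_bigr _ (fun j _ => UUd j)).
rewrite big_split/= ler_pM2r; last by apply: prodr_gt0 => j _; case: Ut.
have -> : \prod_j U0 j j = 2^-1 ^+ d * (s0 * `|y 0 i|).
  under eq_bigr do rewrite mxE eqxx.
  rewrite big_split/= prodr_const card_ord; congr (_ * _).
  by rewrite (bigD1 i)//= eqxx big1 ?mulr1// => j /negPf ->.
have p2 : 0 < 2 ^+ d :> R by rewrite exprn_gt0.
rewrite exprVn ler_pdivlMl//.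
have : 2 ^+ d.+2 * (1 + mu) <= `|y 0 i| by exact: ltW.
rewrite !exprS => h.
apply: (@le_trans _ _ (s0 * (2 * (2 * 2 ^+ d) * (1 + mu)))); last by rewrite ler_pM2l.
by rewrite mulrCA (mulrC s0) -!mulrA; move: s0mu; rewrite mulrC => ->; lra.
Qed.

End inscribed_boxes.

(** * Approximation by unions of grid cells *)

Lemma bernoulli_ineq (R : realType) (x : R) n : 0 <= x -> x <= 1 ->
  1 - x *+ n <= (1 - x) ^+ n.
Proof.
move=> x0 x1; elim: n => [|n IH]; first by rewrite mulr0n subr0 expr0.
rewrite exprS mulrSr; have nx : 0 <= x *+ n by rewrite mulrn_wge0.
nra.
Qed.

Section grid_bodies.
Context {R : realType} {d G : nat}.
Variables (C h : R).
Local Notation V := 'rV[R]_d.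
Local Notation grid_index := {ffun 'I_d -> 'I_G}.
Implicit Types (K : set V) (U : 'M[R]_d) (t : V) (T : {set grid_index}).

Definition corner (k : grid_index) : V := \row_j (h * (k j)%:R - C).

Definition cell k : set V := box (corner k) (corner k + const_mx h).

(** The cells of T have total volume #|T| h^d, and the product of the
    diagonal is det U, so v bounds from below the volume of the image of
    these cells. *)
Definition grid_fits (v : R) T K U t := [/\ upper_tri U,
  v <= #|T|%:R * h ^+ d * \prod_i U i i &
  forall k, k \in T -> forall p, cell k p -> K (p *m U + t)].

Hypothesis h0 : 0 < h.

Lemma cell_disjoint k l p : cell k p -> cell l p -> k = l.
Proof.
move=> pk pl; apply/ffunP => j; apply/val_inj/eqP.
have := pk j; have := pl j; rewrite !mxE => /andP[l1 l2] /andP[k1 k2].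
have lt (m n : nat) : h * m%:R - C <= p 0 j -> p 0 j < h * n%:R - C + h -> (m <= n)%N.
  move=> m1 n1; have : h * m%:R < h * n.+1%:R by rewrite -natr1; nra.
  by rewrite ltr_pM2l// ltr_nat.
by rewrite eqn_leq (lt _ _ k1 l2) (lt _ _ l1 k2).
Qed.

Lemma grid_fits_volume v T K U t : grid_fits v T K U t -> (v%:E <= volume K)%E.
Proof.
move=> [Ut vT KT].
have := @volume_paras_ge R d grid_index T U t corner (fun k => corner k + const_mx h) K Ut.
move=> /(_ _ cell_disjoint) H.
apply: le_trans (H _ _); last 2 first.
- by move=> k j; rewrite !mxE lerDl ltW.
- by move=> k kT x [p pk <-]; exact: KT kT _ pk.
rewrite lee_fin; apply: le_trans vT _; rewrite le_eqVlt; apply/orP; left; apply/eqP.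
transitivity (\sum_(k in T) h ^+ d * \prod_i U i i).
  by rewrite sumr_const -[RHS](mulr_natl (h ^+ d * _)) mulrA.
apply: eq_bigr => k _; rewrite [RHS](eq_bigr (fun i => h * U i i)) => [|i _].
  by rewrite big_split/= prodr_const card_ord.
by rewrite !mxE addrAC subrr add0r.
Qed.

Lemma grid_fitsS v T K K' U t : K `<=` K' -> grid_fits v T K U t ->
  grid_fits v T K' U t.
Proof. by move=> KK' [? ? KT]; split => // k kT p kp; apply: KK'; exact: KT kT _ kp. Qed.

(** Only the lower bound on the product of the diagonal is not linear in U;
    it is preserved because the logarithm is concave. *)
Lemma grid_fits_conv v T K U t U' t' (s : R) : convex_set K -> 0 < v ->
  grid_fits v T K U t -> grid_fits v T K U' t' -> 0 <= s -> s <= 1 ->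
  grid_fits v T K (s *: U + (1 - s) *: U') (s *: t + (1 - s) *: t').
Proof.
move=> /convex_setP cK v0 [[U0 Ud] vU KU] [[U0' Ud'] vU' KU'] s0 s1.
have comb0 (x y : R) : 0 < x -> 0 < y -> 0 < s * x + (1 - s) * y.
  move=> x0 y0; have [->|sn0] := eqVneq s 0; first lra.
  have sp : 0 < s by rewrite lt_neqAle eq_sym sn0.
  nra.
split.
- split=> [i j ij|i]; first by rewrite !mxE U0// U0'// !mulr0 addr0.
  by rewrite !mxE comb0.
- set N := #|T|%:R * h ^+ d in vU vU' *.
  have P0 : 0 < \prod_i U i i by exact: prodr_gt0.
  have P0' : 0 < \prod_i U' i i by exact: prodr_gt0.
  have N0 : 0 < N by move: (lt_le_trans v0 vU); rewrite pmulr_lgt0.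
  pose m := Num.min (\prod_i U i i) (\prod_i U' i i).
  have m0 : 0 < m by rewrite lt_min P0 P0'.
  apply: (@le_trans _ _ (N * m)).
    by rewrite /m minEle; case: ifP => _; [exact: vU|exact: vU'].
  rewrite ler_pM2l// -ler_ln ?posrE//; last first.
    by apply: prodr_gt0 => i _; rewrite !mxE comb0.
  have lnprod (f : 'I_d -> R) : (forall i, 0 < f i) ->
      ln (\prod_i f i) = \sum_i ln (f i).
    move=> f0; have : 0 < \prod_i f i /\ ln (\prod_i f i) = \sum_i ln (f i).
      elim/big_rec2: _ => [|i x y _ [y0 e]]; first by rewrite ln1.
      by rewrite mulr_gt0// lnM ?posrE// e.
    by case.
  rewrite lnprod => [|i]; last by rewrite !mxE comb0.
  apply: (@le_trans _ _ (s * (\sum_i ln (U i i)) + (1 - s) * (\sum_i ln (U' i i)))).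
    have l1 : ln m <= \sum_i ln (U i i).
      by rewrite -lnprod// ler_ln ?posrE// ge_min lexx.
    have l2 : ln m <= \sum_i ln (U' i i).
      by rewrite -lnprod// ler_ln ?posrE// ge_min lexx orbT.
    nra.
  rewrite !mulr_sumr -big_split/=; apply: ler_sum => i _; rewrite !mxE.
  exact: (@concave_ln R (Itv01 s0 s1) _ _ (Ud i) (Ud' i)).
- move=> k kT p kp.
  have -> : p *m (s *: U + (1 - s) *: U') + (s *: t + (1 - s) *: t') =
      s *: (p *m U + t) + (1 - s) *: (p *m U' + t').
    by rewrite mulmxDr -!scalemxAr addrACA -!scalerDr.
  by apply: cK => //; [exact: KU kT _ kp|exact: KU' kT _ kp].
Qed.

Lemma grid_locate (z : V) : (forall j, - C <= z 0 j < h * G%:R - C) ->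
  exists k, cell k z.
Proof.
move=> zC.
have kG (j : 'I_d) : (Num.truncn ((z 0 j + C) / h)%R < G)%N.
  have /andP[z1 z2] := zC j.
  rewrite truncn_lt_nat ?ltr_pdivrMr//; first lra.
  by rewrite divr_ge0 ?(ltW h0)//; lra.
exists [ffun j => Ordinal (kG j)] => j; rewrite !mxE ffunE /=.
have /andP[z1 z2] := zC j.
have : 0 <= (z 0 j + C) / h by rewrite divr_ge0 ?(ltW h0)//; lra.
move=> /truncn_itv; set k := Num.truncn _; rewrite ler_pdivlMr// ltr_pdivrMr// -natr1.
move=> /andP[? ?]; apply/andP; split; nra.
Qed.

End grid_bodies.

Section approximation.
Context {R : realType} {d : nat}.
Local Notation V := 'rV[R]_d.

(** Either some inscribed parallelepiped is already large, or the products
    of the diagonals are bounded and one of them exceeds half of their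
    supremum. *)
Lemma maximal_inscribed (K : set V) : (0 < d)%N -> convex_set K ->
  volume K != 0%E ->
  (exists U t, inscribed K U t /\ 1 <= 2 ^+ d * \prod_i U i i) \/
  (exists U t, inscribed K U t /\ forall U' t', inscribed K U' t' ->
     \prod_i U' i i < 2 * \prod_i U i i).
Proof.
move=> d0 cK vK.
have [big|small] := pselect (exists U t, inscribed K U t /\ 1 <= 2 ^+ d * \prod_i U i i).
  by left.
right; have [U0 [t0 KU0]] := exists_inscribed d0 cK vK.
pose S := [set s | exists U t, inscribed K U t /\ s = \prod_i U i i].
have prod0 U t : inscribed K U t -> 0 < \prod_i U i i.
  by move=> [[_ Ud] _]; exact: prodr_gt0.
have p2 : 0 < 2 ^+ d :> R by rewrite exprn_gt0.
have supS : has_sup S.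
  split; first by exists (\prod_i U0 i i), U0, t0.
  exists (2 ^+ d)^-1 => s [U [t [KU ->]]]; rewrite leNgt; apply/negP => h.
  apply: small; exists U, t; split => //.
  by rewrite mulrC -ler_pdivrMr// mul1r ltW.
have le_sup U t : inscribed K U t -> \prod_i U i i <= sup S.
  by move=> KU; apply: ub_le_sup; [exact: supS.2|exists U, t].
have sup0 : 0 < sup S by exact: lt_le_trans (prod0 _ _ KU0) (le_sup _ _ KU0).
have [|s [U [t [KU sE]]] ss] := @sup_adherent _ S (sup S / 2) _ supS.
  by rewrite divr_gt0.
exists U, t; split => // U' t' /le_sup; move: ss; rewrite sE; lra.
Qed.

(** If some inscribed parallelepiped is large, the full grid carried by it
    will do. Otherwise, in the coordinates of a nearly maximal inscribed
    parallelepiped, K contains [-1, 1]^d and is contained in [-C, C]^d. Put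
    r = 1 - delta. A cell of side at most delta that meets r K lies in r K
    + delta [-1, 1]^d, hence in K by convexity. The cells meeting r K,
    dilated by 1 / r, cover K, so their total volume is at least r^d, which
    is at least 1 - d delta = 1 - eps. *)
Lemma grid_approximation (eps : R) : (0 < d)%N -> 0 < eps -> eps < 1 ->
  exists (G : nat) (C h : R), 0 < h /\
  forall K : set V, convex_set K -> (1 <= volume K)%E ->
  exists (T : {set {ffun 'I_d -> 'I_G}}) U t, grid_fits C h (1 - eps) T K U t.
Proof.
move=> d0 e0 e1; pose C := @outer_radius R d d; pose delta := eps / d%:R.
have dR : 0 < d%:R :> R by rewrite ltr0n.
have delta0 : 0 < delta by rewrite divr_gt0.
have delta1 : delta < 1.
  by rewrite ltr_pdivrMr// mul1r (lt_le_trans e1)// ler1n.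
have C0 : 0 < C.
  have pos n : (0 < n)%N -> 0 < @outer_radius R d n.
    by case: n => //= n _; rewrite mulr_gt0 ?exprn_gt0// ltr_pwDl// outer_radius_ge0.
  exact: pos.
pose G := (Num.truncn (2 * C / delta)).+1; pose h := 2 * C / G%:R.
have GR : 0 < G%:R :> R by rewrite ltr0n.
have h0 : 0 < h by rewrite divr_gt0// mulr_gt0.
have hG : h * G%:R = 2 * C by rewrite divfK// gt_eqF.
have h_delta : h <= delta.
  by rewrite /h ler_pdivrMr// [leRHS]mulrC -ler_pdivrMr// ltW// truncnS_gt.
exists G, C, h; split => // K cK vK.
have vK0 : volume K != 0%E.
  by rewrite gt_eqF// (lt_le_trans _ vK)// lte_fin.
have [[U [t [[[U0 Ud] KU] Ubig]]]|[U [t [KU Umax]]]] := maximal_inscribed d0 cK vK0.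
  exists [set: _]%SET, (C^-1 *: U), t; split.
  - split=> [i j ij|i]; first by rewrite mxE U0 ?mulr0.
    by rewrite mxE mulr_gt0 ?invr_gt0.
  - rewrite cardsT card_ffun !card_ord natrX.
    rewrite [X in _ * X](eq_bigr (fun i => C^-1 * U i i)) => [|i _]; last by rewrite mxE.
    rewrite big_split/= prodr_const card_ord mulrA -!exprMn (mulrC G%:R) hG mulfK ?gt_eqF//.
    lra.
  - move=> k _ p kp; rewrite -scalemxAr scalemxAl; apply: KU => j.
    rewrite mxE normrM gtr0_norm ?invr_gt0// ler_pdivrMl// mulr1.
    have kG : (k j)%:R + 1 <= G%:R :> R by rewrite natr1 ler_nat.
    have k0 : 0 <= (k j)%:R :> R by [].
    have := kp j; rewrite !mxE ler_norml => /andP[k1 k2]; apply/andP; split; nra.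
have cov := near_maximal_inscribed_covers cK KU Umax.
case: KU => Ut KU; pose r := 1 - delta.
have r0 : 0 < r by rewrite /r; lra.
have Uu : U \in unitmx by case: Ut; exact: upper_unit.
pose T := [set k : {ffun 'I_d -> 'I_G} |
  `[< exists2 y, K (y *m U + t) & cell C h k (r *: y) >]]%SET.
exists T, U, t; split => //; last first.
  move=> k; rewrite inE => /asboolP[y Ky ky] p kp.
  pose e := delta^-1 *: (p - r *: y).
  have -> : p *m U + t = r *: (y *m U + t) + (1 - r) *: (e *m U + t).
    have -> : p = r *: y + delta *: e.
      by rewrite /e scalerA mulfV ?gt_eqF// scale1r addrC subrK.
    have -> : 1 - r = delta by rewrite /r; lra.
    rewrite mulmxDl -!scalemxAl [in RHS]scalerDr [X in _ = _ + X]scalerDr addrACA.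
    by rewrite -(scalerDl t) /r subrK scale1r.
  apply: ((convex_setP _).1 cK) => //; [|by rewrite ltW|by rewrite /r; lra].
  apply: KU => j; rewrite /e mxE normrM gtr0_norm ?invr_gt0// ler_pdivrMl// mulr1.
  apply: le_trans h_delta; move: (kp j) (ky j); rewrite !mxE ler_norml.
  by move=> /andP[? ?] /andP[? ?]; apply/andP; split; lra.
pose pr := \prod_i U i i.
have pr0 : 0 < pr by apply: prodr_gt0 => i _; case: Ut.
have : (1 <= (#|T|%:R * (h ^+ d * r^-1 ^+ d * pr))%:E)%E.
  apply: (le_trans vK).
  pose F (k : {ffun 'I_d -> 'I_G}) :=
    para U t (r^-1 *: corner C h k) (r^-1 *: (corner C h k + const_mx h)).
  have FE k : volume (F k) = (h ^+ d * r^-1 ^+ d * pr)%:E.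
    rewrite volume_para//; last by move=> j; rewrite !mxE ler_pM2l ?invr_gt0// lerDl ltW.
    rewrite (eq_bigr (fun i => (h * r^-1) * U i i)) => [|i _].
      by rewrite big_split/= prodr_const card_ord exprMn.
    by rewrite !mxE; congr (_ * _); ring.
  apply: (@le_trans _ _ (volume (\big[setU/set0]_(k <- enum T) F k))).
    apply: le_volume => x Kx.
    pose y := (x - t) *m invmx U.
    have xE : x = y *m U + t by rewrite /y mulmxKV// subrK.
    rewrite xE in Kx.
    have [|k ky] := @grid_locate R d G C h h0 (r *: y).
      move=> j; rewrite hG mxE.
      have := cov y Kx j; have := @outer_radius_le R d j.+1 d (ltn_ord j).
      rewrite -/C => c1 c2; have := le_trans c2 c1; rewrite ler_norml => /andP[y1 y2].
      by rewrite /r; apply/andP; split; nra.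
    rewrite -bigcup_seq; exists k.
      by rewrite /= mem_enum inE; apply/asboolP; exists y.
    exists y => // j; move: (ky j); rewrite !mxE.
    by rewrite ler_pdivrMl// ltr_pdivlMl.
  apply: le_trans (volume_bigU_le _ _) _.
  rewrite (eq_bigr (fun=> (h ^+ d * r^-1 ^+ d * pr)%:E))// sumEFin lee_fin.
  by rewrite big_enum/= sumr_const -[leLHS]mulr_natl.
rewrite lee_fin => H.
have rd : 1 - eps <= r ^+ d.
  apply: le_trans (bernoulli_ineq d (ltW delta0) (ltW delta1)).
  by rewrite -mulr_natr divfK// gt_eqF.
apply: (le_trans rd); rewrite -[leLHS]mulr1 -ler_pdivlMl ?exprn_gt0//.
apply: (le_trans H); rewrite exprVn le_eqVlt; apply/orP; left; apply/eqP.
by rewrite -/pr; ring.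
Qed.

End approximation.

(** * Piercing by bodies of prescribed volume *)

(** The convex set K may be unbounded; its intersection with a large cube
    still contains all the cells. *)
Lemma grid_fits_convex_body (R : realType) (d G : nat) (C h v : R)
    (T : {set {ffun 'I_d -> 'I_G}}) (K : set 'rV[R]_d) U t :
  (0 < d)%N -> 0 < h -> 0 <= v -> convex_set K -> grid_fits C h v T K U t ->
  exists B : set 'rV[R]_d, [/\ convex_set B, B `<=` K & volume B = v%:E].
Proof.
move=> d0 h0 v0 cK fits.
pose m := `|C| + h * G%:R.
pose r := 1 + \sum_j `|t 0 j| + \sum_i \sum_j m * `|U i j|.
pose W := [set x : 'rV[R]_d | forall j, - r <= x 0 j < r].
have cW : convex_set W.
  apply/convex_setP => x y s xW yW s0 s1 j; rewrite !mxE.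
  have /andP[x1 x2] := xW j; have /andP[y1 y2] := yW j.
  apply/andP; split; first nra.
  have [->|sn0] := eqVneq s 0; first lra.
  have sp : 0 < s by rewrite lt_neqAle eq_sym sn0.
  nra.
have m0 : 0 <= m by rewrite addr_ge0// mulr_ge0// ltW.
have fitsW : grid_fits C h v T (K `&` W) U t.
  case: fits => Ut vT KT; split => // k kT p kp; split; first exact: KT kp.
  move=> j; suff : `|(p *m U + t) 0 j| < r.
    by rewrite ltr_norml => /andP[/ltW -> ->].
  have pm i : `|p 0 i| <= m.
    have kG : (k i)%:R + 1 <= G%:R :> R by rewrite natr1 ler_nat.
    have k0 : 0 <= (k i)%:R :> R by [].
    have := kp i; rewrite !mxE /m => /andP[p1 p2].
    have := ler_norm C; have := ler_norm (- C); rewrite normrN => C1 C2.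
    by rewrite ler_norml; apply/andP; split; nra.
  rewrite mxE; apply: le_lt_trans (ler_normD _ _) _.
  have t1 : `|t 0 j| <= \sum_j `|t 0 j| by rewrite (bigD1 j)//= lerDl sumr_ge0.
  have t2 : `|(p *m U) 0 j| <= \sum_i \sum_j m * `|U i j|.
    rewrite mxE; apply: le_trans (ler_norm_sum _ _ _) _; apply: ler_sum => i _.
    rewrite (bigD1 j)//= normrM; apply: (@le_trans _ _ (m * `|U i j|)).
      by rewrite ler_wpM2r.
    by rewrite lerDl sumr_ge0// => k' _; rewrite mulr_ge0.
  by rewrite /r; lra.
have vol := grid_fits_volume h0 fitsW.
have [|B [cB BK vB]] := exists_convex_subset_volume d0 (convex_setI cK cW) _ v0 vol (r := r).
  by move=> x [].
by exists B; split => // x /BK[].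
Qed.

Theorem corollary1p3 (R : realType) (d : nat) (hd : (0 < d)%N)
    (eps : R) (heps0 : 0 < eps) (heps1 : eps < 1) :
  exists n : nat, forall p q : nat,
    (0 < p)%N -> (0 < q)%N -> (n <= q)%N -> (q <= p)%N ->
  exists c : nat, forall (I : finType) (F : I -> set 'rV[R]_d),
    (forall i, convex_set (F i)) ->
    (forall i, (1 <= volume (F i))%E) ->
    (forall P : {set I}, #|P| = p ->
      exists Q : {set I}, [/\ Q \subset P, #|Q| = q &
        (1 <= volume (\bigcap_(i in [set` Q]) F i))%E]) ->
  exists C : 'I_c -> set 'rV[R]_d,
    [/\ forall j, convex_set (C j),
        forall j, volume (C j) = (1 - eps)%:E &
        forall i, exists j, C j `<=` F i].
Proof.
pose D := (d * d + d)%N.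
have D0 : (0 < D)%N by rewrite addn_gt0 hd orbT.
have [G [C [h [h0 approx]]]] := @grid_approximation R d eps hd heps0 heps1.
have v0 : 0 < 1 - eps by lra.
exists D.+1 => p q _ _ Dq _.
pose T : finType := {set {ffun 'I_d -> 'I_G}}.
have [c pierce] := @bounded_piercing R D T p D0.
exists c => I F cF vF Fpq.
pose lin (z : 'rV[R]_D) : 'M[R]_d := vec_mx (lsubmx z).
pose off (z : 'rV[R]_D) : 'rV[R]_d := rsubmx z.
pose fits (T0 : T) (K : set 'rV[R]_d) z :=
  grid_fits C h (1 - eps) T0 K (lin z) (off z).
have approx_fits (K : set 'rV[R]_d) : convex_set K -> (1 <= volume K)%E ->
    exists (T : T) z, fits T K z.
  move=> cK /(approx K cK)[T0 [U [t KU]]]; exists T0, (row_mx (mxvec U) t).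
  by rewrite /fits /lin /off row_mxKl row_mxKr mxvecK.
have [|||Z ZP] := pierce I (fun T i => [set z | fits T (F i) z]).
- move=> T0 i; apply/convex_setP => z z' s zF zF' s0 s1.
  rewrite /= /fits /lin /off !linearD !linearZ /=.
  exact: grid_fits_conv.
- by move=> i; exact: approx_fits.
- move=> P /Fpq[Q [QP Qq vQ]]; exists Q; split => //; first by rewrite Qq.
  have [|T0 [z fz]] := approx_fits _ _ vQ; first exact: convex_bigcap.
  by exists T0, z => i iQ; apply: grid_fitsS fz => x; apply.
have /choice[B BP] j : exists B : set 'rV[R]_d, [/\ convex_set B,
    volume B = (1 - eps)%:E & forall i, fits (Z j).1 (F i) (Z j).2 -> B `<=` F i].
  have [[i0 fi0]|nofit] := pselect (exists i, fits (Z j).1 (F i) (Z j).2).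
    pose K := \bigcap_(i in [set i | fits (Z j).1 (F i) (Z j).2]) F i.
    have fK : fits (Z j).1 K (Z j).2.
      case: (fi0) => Ut vT _; split => // k kT x kx i fi.
      by case: fi => _ _; apply; [exact: kT|].
    have cK : convex_set K by exact: convex_bigcap.
    have [B [cB BK vB]] := grid_fits_convex_body hd h0 (ltW v0) cK fK.
    by exists B; split => // i fi x /BK; apply.
  (* No member is attached to this point of the piercing set; any body will
     do. *)
  have cube : volume (box (const_mx 0) (const_mx 1) : set 'rV[R]_d) = 1%:E.
    rewrite volume_box => [|j']; last by rewrite !mxE.
    by congr _%:E; rewrite big1// => i _; rewrite !mxE subr0.
  have [T0 [z fz]] : exists (T : T) z, fits T setT z.
    apply: approx_fits; first by move=> x y l _ _; rewrite inE.
    by rewrite -cube; exact: le_volume.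
  have [|B [cB _ vB]] := grid_fits_convex_body hd h0 (ltW v0) _ fz.
    by move=> x y l _ _; rewrite inE.
  by exists B; split => // i fi; case: nofit; exists i.
exists B; split => [j|j|i]; [by case: (BP j)|by case: (BP j)|].
by have [k kF] := ZP i; exists k; case: (BP k) => _ _; exact.
Qed.
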